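(* Let $M_3$ be the 3-hypergraph defined in the context. Then $M_3$ is a countably infinite set-homogeneous 3-hypergraph which is not homogeneous and whose automorphism group is not 2-transitive. Moreover, every countably infinite ${\le}4$-set-homogeneous 3-hypergraph whose automorphism group is not 2-transitive on its vertex set is isomorphic to $M_3$.
   Context: A $k$-hypergraph is a pair $(M,E)$ where $E$ is a set of $k$-element subsets of $M$ (the edges); $k$-subsets not in $E$ are non-edges. Substructures are induced subhypergraphs. All structures considered are countable (finite or countably infinite). A countable structure $M$ is $t$-set-homogeneous if whenever $U,V\subseteq M$ with $|U|=|V|=t$ carry isomorphic induced substructures, there is $g\in\mathrm{Aut}(M)$ with $U^g=V$; it is ${\le}t$-set-homogeneous if it is $s$-set-homogeneous for all $1\le s\le t$, and set-homogeneous if it is $t$-set-homogeneous for all $t\ge 1$. It is homogeneous if every isomorphism between finite induced substructures extends to an automorphism. A permutation group is $2$-transitive if it is transitive on ordered pairs of distinct points. A $C$-relation on a set $M$ is a ternary relation $C$ satisfying, for all $x,y,z,w\in M$: (C1) $C(x;y,z)\to C(x;z,y)$; (C2) $C(x;y,z)\to\neg C(y;x,z)$; (C3) $C(x;y,z)\to (C(x;w,z)\vee C(w;y,z))$; (C4) $x\ne y\to C(x;y,y)$; (C5) $\exists x\, C(x;y,z)$; (C6) $x\ne y\to\exists z(y\ne z\wedge C(x;y,z))$. Call it 2-regular if for all distinct $x,y,z$ at least one of $C(x;y,z),C(y;x,z),C(z;x,y)$ holds. A total order $\le$ on $M$ is compatible with $C$ if $x<y<z$ implies $C(x;y,z)\vee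 C(z;x,y)$. Strong density means: $\le$ is dense without endpoints, and (C8) whenever $C(x;y,z)$ there exist $w_1,w_2$ with $C(w_1;y,z)\wedge C(x;y,w_1)\wedge w_1<\min\{y,z\}$ and $C(w_2;y,z)\wedge C(x;y,w_2)\wedge \max\{y,z\}<w_2$. There is, up to isomorphism, a unique countably infinite structure $(M,C,\le)$ with $C$ a 2-regular $C$-relation satisfying (C1)–(C6), $\le$ a compatible total order, and strong density; it is homogeneous in the language $\{C,\le\}$. $M_3=(M,E)$ is the 3-hypergraph on this $M$ whose edges are the 3-sets $\{x,y,z\}$ of distinct elements with $x<y$, $x<z$ and $C(x;y,z)$. *)

(* Defs.v *)
From mathcomp Require Import all_boot finmap.
Set Implicit Arguments. Unset Strict Implicit. Unset Printing Implicit Defensive.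
Local Open Scope fset_scope.

Section Hyper.
Variable V : choiceType.
Implicit Types (E : {fset V} -> Prop) (U W S : {fset V}).

Definition hyper3 E : Prop := forall S, E S -> #|` S| = 3.

Definition is_aut E (g : V -> V) : Prop :=
  bijective g /\ forall S, #|` S| = 3 -> (E S <-> E (g @` S)).

Definition partial_iso E (U : {fset V}) (f : V -> V) : Prop :=
  {in U &, injective f} /\
  forall S, S `<=` U -> #|` S| = 3 -> (E S <-> E (f @` S)).

Definition t_set_hom E (t : nat) : Prop :=
  forall U W, #|` U| = t -> #|` W| = t ->
    (exists f, partial_iso E U f /\ f @` U = W) ->
    exists g, is_aut E g /\ g @` U = W.

Definition le_set_hom E (t : nat) : Prop :=
  forall s, 1 <= s <= t -> t_set_hom E s.

Definition set_hom E : Prop := forall t, 1 <= t -> t_set_hom E t.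

Definition homogeneous E : Prop :=
  forall U (f : V -> V), partial_iso E U f ->
    exists g, is_aut E g /\ {in U, g =1 f}.

Definition two_transitive E : Prop :=
  forall a b c d : V, a <> b -> c <> d ->
    exists g, is_aut E g /\ g a = c /\ g b = d.
End Hyper.

Definition countably_infinite (V : countType) : Prop :=
  forall s : seq V, exists x, x \notin s.

Definition hyper_iso (V W : choiceType) (E : {fset V} -> Prop)
  (F : {fset W} -> Prop) : Prop :=
  exists phi : V -> W, bijective phi /\
    forall S : {fset V}, #|` S| = 3 -> (E S <-> F (phi @` S)).

(** * The C-relation structure (M, C, <=).  C x y z stands for C(x;y,z). *)
Section CStruct.
Variable M : Type.
Variables (C : M -> M -> M -> Prop) (le : M -> M -> Prop).
Definition lt (x y : M) : Prop := le x y /\ x <> y.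

Definition C_relation : Prop :=
  (forall x y z, C x y z -> C x z y) /\
  (forall x y z, C x y z -> ~ C y x z) /\
  (forall x y z w, C x y z -> C x w z \/ C w y z) /\
  (forall x y, x <> y -> C x y y) /\
  (forall y z, exists x, C x y z) /\
  (forall x y, x <> y -> exists z, y <> z /\ C x y z).

Definition two_regular : Prop :=
  forall x y z, x <> y -> y <> z -> x <> z -> C x y z \/ C y x z \/ C z x y.

Definition total_order : Prop :=
  (forall x, le x x) /\ (forall x y, le x y -> le y x -> x = y) /\
  (forall x y z, le x y -> le y z -> le x z) /\ (forall x y, le x y \/ le y x).

Definition compatible : Prop :=
  forall x y z, lt x y -> lt y z -> C x y z \/ C z x y.

Definition strongly_dense : Prop :=
  (forall x y, lt x y -> exists z, lt x z /\ lt z y) /\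
  (forall x, exists y, lt y x) /\ (forall x, exists y, lt x y) /\
  (forall x y z, C x y z ->
     (exists w1, C w1 y z /\ C x y w1 /\ lt w1 y /\ lt w1 z) /\
     (exists w2, C w2 y z /\ C x y w2 /\ lt y w2 /\ lt z w2)).

Definition CL_structure : Prop :=
  [/\ C_relation, two_regular, total_order, compatible & strongly_dense].
End CStruct.

Definition M3_edge (M : choiceType) (C : M -> M -> M -> Prop)
  (le : M -> M -> Prop) (S : {fset M}) : Prop :=
  exists x y z : M, [/\ S = [fset x; y; z], x <> y, y <> z, x <> z &
     [/\ lt le x y, lt le x z & C x y z]].

(* Main.v *)
(* The order of [M3] is definable from its edges, so automorphisms preserve it.
   The root splitting of a finite substructure is determined by the edges up to
   exchanging two twins, so isomorphic finite subhypergraphs carry isomorphic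
   C-relations and orders; back and forth then yields set-homogeneity.

   If [F] is 4-set-homogeneous and its automorphism group G is not 2-transitive,
   then G is transitive on pairs and preserves a tournament T.  By
   3-set-homogeneity, either T is a linear order, or the 3-cycles of T are exactly
   the edges or exactly the non-edges.  In the second case T is a local order, and
   back and forth gives an anti-automorphism of T; it preserves [F] but not T,
   a contradiction.  If T is a linear order, each number of edges is realized by
   at most one ordered type of 4-sets, and amalgamating two 4-sets over a common
   triple leaves, by a finite computation, only the types of [M3] or their mirror
   images.  These types say that [F] comes from a C-relation for T or its
   reverse, and such structures are unique by back and forth. *)
Require Import Defs.
From Stdlib Require Import Classical ClassicalEpsilon.
From mathcomp Require Import all_boot finmap.
Set Implicit Arguments. Unset Strict Implicit. Unset Printing Implicit Defensive.
Local Open Scope fset_scope.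

(** Set-homogeneity prescribes the image of a finite set, not the map on it. For M_3 this leaves
    room to replace a given isomorphism by another one with the same image; the given one may fail
    to extend, already on two points. In the converse direction the tournament supplies the missing
    information: an automorphism carrying one finite set linearly ordered by it onto another does so
    in increasing order, so transitivity on sets becomes transitivity on ordered tuples. Four points
    are enough because edges on a 4-set are complements of points: the number of edges is the only
    isomorphism invariant, and it fixes the ordered type as well. A 5-set is then a puzzle of five
    types that agree on common triples, which leaves finitely many sets of types to test. *)

Definition asbool (P : Prop) : bool := excluded_middle_informative P.

Lemma asboolP (P : Prop) : reflect P (asbool P).
Proof. by rewrite /asbool; case: excluded_middle_informative => h; constructor. Qed.

(** * Back and forth *)

Lemma exists_maximal (T : eqType) (R : T -> T -> Prop) (P : T -> Prop) (s : seq T) :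
  (forall x, ~ R x x) -> (forall y x z, R x y -> R y z -> R x z) ->
  (exists2 x, x \in s & P x) ->
  exists m, [/\ m \in s, P m & forall n, n \in s -> P n -> ~ R m n].
Proof.
move=> Rirr Rtr; elim: s => [[x //]|a s IH exas].
have [exs|nos] := classic (exists2 x, x \in s & P x); last first.
  have [Pa|nPa] := classic (P a); last first.
    case: exas => x; rewrite inE => /orP[/eqP->|xs] Px; [by []|by case: nos; exists x].
  exists a; split; rewrite ?mem_head // => n; rewrite inE => /orP[/eqP-> _|ns Pn]; first exact: Rirr.
  by case: nos; exists n.
have [m [ms Pm mmax]] := IH exs.
have [[Pa Rma]|nRma] := classic (P a /\ R m a).
  exists a; split; rewrite ?mem_head // => n; rewrite inE => /orP[/eqP-> _|ns Pn Ran]; first exact: Rirr.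
  exact: (mmax n ns Pn (Rtr _ _ _ Rma Ran)).
exists m; split; rewrite ?inE ?ms ?orbT // => n; rewrite inE => /orP[/eqP-> Pa Rm|]; last exact: mmax.
by apply: nRma.
Qed.

Section BackAndForth.
Variables (A B : countType) (P : seq (A * B) -> Prop).
Hypothesis P_forth : forall p, P p -> forall a, exists b, P ((a, b) :: p).
Hypothesis P_back : forall p, P p -> forall b, exists a, P ((a, b) :: p).
Hypothesis P_inj : forall p a b a' b', P p -> (a, b) \in p -> (a', b') \in p ->
  (a = a' <-> b = b').

(** One stage serves both sides, since the codes of [pickle] number the points of [A] and of [B] at
    once; a number that codes no point changes nothing. *)
Lemma extension_step p (n : nat) : P p -> exists q, [/\ P q, {subset p <= q},
  forall a : A, choice.unpickle n = Some a -> exists b, (a, b) \in q &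
  forall b : B, choice.unpickle n = Some b -> exists a, (a, b) \in q].
Proof.
move=> Pp.
have [q [Pq pq qa]] : exists q, [/\ P q, {subset p <= q} &
    forall a : A, choice.unpickle n = Some a -> exists b, (a, b) \in q].
  case: (choice.unpickle n : option A) => [a|]; last by exists p; split.
  have [b Pb] := P_forth Pp a; exists ((a, b) :: p); split=> //.
    by move=> x xp; rewrite inE xp orbT.
  by move=> _ [<-]; exists b; rewrite mem_head.
case: (choice.unpickle n : option B) => [b|]; last by exists q; split.
have [a Pa] := P_back Pq b; exists ((a, b) :: q); split=> //.
- by move=> x xp; rewrite inE pq ?orbT.
- by move=> a' /qa[b' ab']; exists b'; rewrite inE ab' orbT.
by move=> _ [<-]; exists a; rewrite mem_head.
Qed.

(** Relations of bounded arity pass from [P] to [phi] through the last conclusion, which puts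
    finitely many points into one approximation. *)
Lemma back_and_forth p0 : P p0 -> exists phi : A -> B, [/\ bijective phi,
  forall a b, (a, b) \in p0 -> phi a = b &
  forall s : seq A, exists2 p, P p & forall a, a \in s -> (a, phi a) \in p].
Proof.
move=> Pp0.
(* Stages carry their proof of [P], so that the chosen extensions can be iterated. *)
pose step n (p : {p | P p}) : {p | P p} :=
  let e := constructive_indefinite_description _ (extension_step n (proj2_sig p)) in
  let: And4 Pq _ _ _ := proj2_sig e in exist _ (proj1_sig e) Pq.
have stepP n (p : {p | P p}) : [/\ {subset sval p <= sval (step n p)},
    forall a : A, choice.unpickle n = Some a -> exists b, (a, b) \in sval (step n p) &
    forall b : B, choice.unpickle n = Some b -> exists a, (a, b) \in sval (step n p)].
  by rewrite /step; case: constructive_indefinite_description => q /= [].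
pose st := fix st n := if n is m.+1 then step m (st m) else exist P p0 Pp0.
have st_mono m n : m <= n -> {subset sval (st m) <= sval (st n)}.
  move=> /subnKC <-; elim: (n - m) => [|k IH]; rewrite ?addn0 ?addnS //.
  by move=> x /IH; case: (stepP (m + k)%N (st (m + k)%N)) => sub _ _; apply: sub.
have stP n : P (sval (st n)) by case: (st n).
have totA a : exists b, exists n, (a, b) \in sval (st n).
  have [_ /(_ a) H _] := stepP (choice.pickle a) (st (choice.pickle a)).
  by have [|b bP] := H; [exact: choice.pickleK | exists b, (choice.pickle a).+1].
have totB b : exists a, exists n, (a, b) \in sval (st n).
  have [_ _ /(_ b) H] := stepP (choice.pickle b) (st (choice.pickle b)).
  by have [|a aP] := H; [exact: choice.pickleK | exists a, (choice.pickle b).+1].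
have inj a b a' b' m n : (a, b) \in sval (st m) -> (a', b') \in sval (st n) ->
    (a = a' <-> b = b').
  move=> /(st_mono _ _ (leq_maxl m n)) h /(st_mono _ _ (leq_maxr m n)) h'.
  exact: (P_inj (stP _) h h').
pose phi a := proj1_sig (constructive_indefinite_description _ (totA a)).
pose psi b := proj1_sig (constructive_indefinite_description _ (totB b)).
have phiP a : exists n, (a, phi a) \in sval (st n).
  by rewrite /phi; case: constructive_indefinite_description.
have psiP b : exists n, (psi b, b) \in sval (st n).
  by rewrite /psi; case: constructive_indefinite_description.
exists phi; split.
- exists psi => [a|b].
    by have [m h] := phiP a; have [n h'] := psiP (phi a); apply/(inj _ _ _ _ _ _ h' h).
  by have [m h] := psiP b; have [n h'] := phiP (psi b); apply/(inj _ _ _ _ _ _ h' h).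
- by move=> a b ab; have [m h] := phiP a; apply/(inj _ _ _ _ m 0 h ab).
move=> s.
suff [n nP] : exists n, forall a, a \in s -> (a, phi a) \in sval (st n).
  by exists (sval (st n)).
elim: s => [|a s [n nP]]; first by exists 0.
have [m h] := phiP a; exists (maxn m n) => x; rewrite inE => /orP[/eqP->|/nP xn].
  exact: (st_mono _ _ (leq_maxl m n)).
exact: (st_mono _ _ (leq_maxr m n)).
Qed.
End BackAndForth.

(** * C-relations with a compatible order *)

Section CLTheory.
Variables (M : Type) (C : M -> M -> M -> Prop) (le : M -> M -> Prop).
Hypothesis clM : CL_structure C le.
Local Notation lt := (lt le).

Lemma C_swap x y z : C x y z -> C x z y.
Proof. by case: clM => -[c1 _] _ _ _ _; apply: c1. Qed.

Lemma C_asym x y z : C x y z -> C y x z -> False.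
Proof. by case: clM => -[_ [c2 _]] _ _ _ _; apply: c2. Qed.

Lemma C_cut x y z w : C x y z -> C x w z \/ C w y z.
Proof. by case: clM => -[_ [_ [c3 _]]] _ _ _ _; apply: c3. Qed.

Lemma C_diag x y : x <> y -> C x y y.
Proof. by case: clM => -[_ [_ [_ [c4 _]]]] _ _ _ _; apply: c4. Qed.

Lemma C_asym' x y z : C x y z -> C z x y -> False.
Proof. by move/C_swap; exact: C_asym. Qed.

Lemma C_neq x y z : C x y z -> x <> y.
Proof. by move=> h e; move: (h); rewrite e in h *; exact: C_asym. Qed.

Lemma C_neq' x y z : C x y z -> x <> z.
Proof. by move/C_swap/C_neq. Qed.

Lemma C_total x y z : x <> y -> y <> z -> x <> z -> C x y z \/ C y x z \/ C z x y.
Proof. by case: clM => _ h _ _ _; apply: h. Qed.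

(* For fixed [x], the relation [C x] is an equivalence relation on the points
   distinct from [x]: its classes are the cones at [x]. *)
Lemma C_trans x u w y : C x u w -> C x w y -> C x u y.
Proof.
move=> h1 h2; case: (C_cut y (C_swap h1)) => [/C_swap //|h3].
by case: (C_cut u h2) => // h; case: (C_asym (C_swap h3) (C_swap h)).
Qed.

Lemma lt_irr x : ~ lt x x.
Proof. by case. Qed.

Lemma lt_trans x y z : lt x y -> lt y z -> lt x z.
Proof.
case: clM => _ _ [_ [anti [tr _]]] _ _ [xy nxy] [yz nyz].
by split; [exact: tr yz | move=> e; apply: nxy; apply: anti => //; rewrite e].
Qed.

Lemma lt_asym x y : lt x y -> lt y x -> False.
Proof. by move=> h /(lt_trans h) /lt_irr. Qed.

Lemma lt_total x y : x <> y -> lt x y \/ lt y x.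
Proof.
case: clM => _ _ [_ [_ [_ tot]]] _ _ n; case: (tot x y) => h; [left | right]; split=> //.
by move=> e; apply: n.
Qed.

Lemma lt_neq x y : lt x y -> x <> y. Proof. by case. Qed.

(** A cone at [x] lies on one side of [x]: if [x] were between [y] and [z], compatibility would
    split off [y] or [z], against (C2). *)
Lemma C_lt x y z : C x y z -> lt x y -> lt x z.
Proof.
move=> h xy; case: (lt_total (C_neq' h)) => // zx.
case: clM => _ _ _ cmp _; case: (cmp _ _ _ zx xy) => [h'|/C_swap h']; first by case: (C_asym' h h').
by case: (C_asym h h').
Qed.

Lemma C_gt x y z : C x y z -> lt y x -> lt z x.
Proof.
move=> h yx; case: (lt_total (C_neq' h)) => // xz.
by case: (lt_asym yx); apply: C_lt (C_swap h) xz.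
Qed.

Lemma lt_C x y z : lt x y -> lt y z -> C x y z \/ C z x y.
Proof. by case: clM => _ _ _ cmp _; apply: cmp. Qed.

Lemma C_above y z : exists x, C x y z.
Proof. by case: clM => -[_ [_ [_ [_ [c5 _]]]]] _ _ _ _; apply: c5. Qed.

Lemma C_below x y : x <> y -> exists z, y <> z /\ C x y z.
Proof. by case: clM => -[_ [_ [_ [_ [_ c6]]]]] _ _ _ _; apply: c6. Qed.

Lemma C_dense x y z : C x y z ->
     (exists w1, C w1 y z /\ C x y w1 /\ lt w1 y /\ lt w1 z) /\
     (exists w2, C w2 y z /\ C x y w2 /\ lt y w2 /\ lt z w2).
Proof. by case: clM => _ _ _ _ [_ [_ [_ h]]]; apply: h. Qed.

(** [C y a u] is read as: [u] is closer to [a] than [y] is. Transitivity provides a closest point in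
    a finite set. *)
Lemma closer_trans y a u v : C y a u -> C u a v -> C y a v.
Proof.
by move=> h1 h2; case: (C_cut v (C_swap h1)) => [/C_swap //|h]; case: (C_asym' h2 h).
Qed.

(* If no point of a set is closer to [a] than [y], each point [u] of it
    satisfies [C a y u] or [C u a y]; this determines the position of [a]. *)

Lemma side_out_in a y u v : C a y u -> C a y v -> C a u v.
Proof. by move=> /C_swap; exact: C_trans. Qed.

Lemma side_out_out a y u v : C u a y -> C v a y -> (C a u v <-> C y u v).
Proof.
move=> hu hv; split=> h.
  by case: (C_cut y h) => // /C_asym'/(_ hv).
by case: (C_cut a h) => // h'; case: (C_asym' h' (C_swap hv)).
Qed.

Lemma side_out_mixed a y u v : C u a y -> C a y v -> ~ C a u v.
Proof. by move=> hu hv h; apply: (C_asym hu (C_trans h (C_swap hv))). Qed.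

Lemma side_mixed a y u v : C u a y -> C a y v -> C u a v.
Proof.
move=> hu hv; case: (C_cut v (C_swap hu)) => [/C_swap //|h].
by case: (C_asym' h (C_swap hv)).
Qed.

Lemma side_below a y u v : C a y u -> (C a y v \/ C v a y) -> ~ C u a v.
Proof.
move=> hu [hv|hv] h; first exact: C_asym h (side_out_in hu hv).
case: (C_cut u (C_swap hv)) => [h'|h']; last by case: (C_asym' hu (C_swap h')).
by case: (C_asym' h h').
Qed.

Lemma side_below_out a y u v : C u a y -> (C u a v <-> C u y v).
Proof. by move=> hu; split; apply: C_trans => //; apply: C_swap. Qed.

End CLTheory.

(** * Extending finite partial isomorphisms of ordered C-relations *)

Definition cl_piso (A B : eqType) (C : A -> A -> A -> Prop) (le : A -> A -> Prop)
    (C' : B -> B -> B -> Prop) (le' : B -> B -> Prop) (p : seq (A * B)) : Prop :=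
  forall x x' y y' z z', (x, x') \in p -> (y, y') \in p -> (z, z') \in p ->
    [/\ x = y <-> x' = y', lt le x y <-> lt le' x' y' & C x y z <-> C' x' y' z'].

Lemma cl_piso_swap (A B : eqType) C le C' le' (p : seq (A * B)) :
  cl_piso C le C' le' p -> cl_piso C' le' C le [seq (u.2, u.1) | u <- p].
Proof.
move=> h x x' y y' z z' /mapP[[? ?] i1 [-> ->]] /mapP[[? ?] i2 [-> ->]] /mapP[[? ?] i3 [-> ->]] /=.
by have [e1 e2 e3] := h _ _ _ _ _ _ i1 i2 i3; split; apply: iff_sym.
Qed.

Section Forth.
Variables (A B : countType) (C : A -> A -> A -> Prop) (le : A -> A -> Prop)
  (C' : B -> B -> B -> Prop) (le' : B -> B -> Prop).
Hypotheses (clA : CL_structure C le) (clB : CL_structure C' le').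

(** In the tree, [a] branches off the path from a closest point [y] to the root. Its relations to
    [p] depend only on which points of [p] branch off below or above that place, and on the side of
    [y]; (C8) gives a point [b] at the corresponding place of the path from [y'], on either side. *)
Lemma cl_forth p : inhabited B -> cl_piso C le C' le' p ->
  forall a, exists b, cl_piso C le C' le' ((a, b) :: p).
Proof.
move=> [b0] pp a.
have [/mapP[[a' b] ab /= ->]|ap] := boolP (a \in map fst p).
  exists b => x x' y y' z z' ix iy iz; apply: pp.
  - by move: ix; rewrite inE => /orP[/eqP->|].
  - by move: iy; rewrite inE => /orP[/eqP->|].
  by move: iz; rewrite inE => /orP[/eqP->|].
have na u : u \in p -> a <> u.1 by move=> up e; case/mapP: ap; exists u.
have {}pp u v w : u \in p -> v \in p -> w \in p -> [/\ u.1 = v.1 <-> u.2 = v.2,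
    lt le u.1 v.1 <-> lt le' u.2 v.2 & C u.1 v.1 w.1 <-> C' u.2 v.2 w.2].
  by case: u v w => [u u'] [v v'] [w w']; apply: pp.
have [->|[y0 y0p]] : p = [::] \/ exists u, u \in p.
  by case: (p) => [|u q]; [left | right; exists u; rewrite mem_head].
  exists b0 => x x' y y' z z'; rewrite !inE => /eqP[-> ->] /eqP[-> ->] /eqP[-> ->].
  split=> //; split; [case=> _ [] | case=> _ [] | move/(C_neq clA) | move/(C_neq clB)] => //.
(* [y] is a point of [p] closest to [a], so each point of [p] branches off this path either below or
   above [a], as [side] records. *)
have [[y y'] [yp _ ymax]] : exists m, [/\ m \in p, True &
    forall n, n \in p -> True -> ~ C m.1 a n.1].
  apply: (exists_maximal (R := fun m n => C m.1 a n.1)) => [x|v u w|].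
  - by move/(C_neq' clA).
  - exact: (closer_trans clA).
  by exists y0.
have side u : u \in p -> C a y u.1 \/ C u.1 a y.
  move=> up; have [<-|yu] := classic (y = u.1); first by left; apply: (C_diag clA); apply: na yp.
  have [h|[h|h]] := C_total clA (na _ yp) yu (na _ up); [by left | | by right].
  by case: (ymax u up I).
(* Among the points branching off below [a], [z] is one farthest from [y], possibly [y] itself;
   [C' b y' z'] then places [b] above all of them. *)
have [[z z'] [zp az zmax]] : exists m, [/\ m \in p, C a y m.1 &
    forall n, n \in p -> C a y n.1 -> ~ C n.1 y m.1].
  apply: (exists_maximal (R := fun m n => C n.1 y m.1)) => [x|v u w h1 h2|].
  - by move/(C_neq' clA).
  - case: (C_cut clA w.1 h1) => // h3.
    by case: (C_asym clA (C_trans clA h3 (C_swap clA h1)) (C_swap clA h2)).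
  by exists (y, y') => //; apply: (C_diag clA); apply: na yp.
(* It suffices to find [b] on the same side of [y'] as [a] is of [y]. *)
have finish b : C' b y' z' -> (lt le a y <-> lt le' b y') ->
    (forall u, u \in p -> C u.1 a y -> C' u.2 b y') ->
    cl_piso C le C' le' ((a, b) :: p).
  move=> byz ltab sideO.
  have sideN u : u \in p -> C a y u.1 -> C' b y' u.2.
    move=> up au; case: (C_cut clB u.2 (C_swap clB byz)) => [/(C_swap clB) //|uzy].
    case: (zmax u up au); apply: (C_swap clA).
    by have [_ _ [_ /(_ uzy)]] := pp _ _ _ up zp yp.
  have sideb u : u \in p -> (C a y u.1 /\ C' b y' u.2) \/ (C u.1 a y /\ C' u.2 b y').
    by move=> up; case: (side u up) => h; [left | right]; split=> //; [exact: sideN | exact: sideO].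
  (* A point compares alike with all points of one of its cones, so the order on the new pairs is
     inherited from [y]. *)
  have ltP (D : Type) (CD : D -> D -> D -> Prop) (leD : D -> D -> Prop) (d e f : D) :
      CL_structure CD leD -> CD d e f -> (lt leD d f <-> lt leD d e) /\ (lt leD f d <-> lt leD e d).
    move=> clD def; split; split; first [exact: (C_lt clD (C_swap clD def)) | exact: (C_lt clD def)
     | exact: (C_gt clD (C_swap clD def)) | exact: (C_gt clD def)].
  have ltba : lt le y a <-> lt le' y' b.
    split=> h; [case: (lt_total clB (C_neq clB byz)) | case: (lt_total clA (C_neq clA az))] => // /ltab.
      by move/(lt_asym clA h).
    by move/(lt_asym clB h).
  have pair u : u \in p -> (a <> u.1 /\ b <> u.2) /\
      ((lt le a u.1 <-> lt le' b u.2) /\ (lt le u.1 a <-> lt le' u.2 b)).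
    move=> up; have [_ l1 _] := pp _ _ _ up yp yp.
    have [_ l2 _] := pp _ _ _ yp up yp.
    case: (sideb u up) => -[h h'].
      split; first by split; [exact: (C_neq' clA h) | exact: (C_neq' clB h')].
      have [-> ->] := ltP _ _ _ _ _ _ clA h; have [-> ->] := ltP _ _ _ _ _ _ clB h'.
      by split.
    split; first by split=> /esym; [exact: (C_neq clA h) | exact: (C_neq clB h')].
    have [<- <-] := ltP _ _ _ _ _ _ clA h; have [<- <-] := ltP _ _ _ _ _ _ clB h'.
    by split.
  have C1 u v : u \in p -> v \in p -> (C a u.1 v.1 <-> C' b u.2 v.2).
    move=> up vp; have [_ _ cy] := pp _ _ _ yp up vp.
    case: (sideb u up) => -[hu hu']; case: (sideb v vp) => -[hv hv'].
    - by split=> _; [apply: (side_out_in clB) hu' hv' | apply: (side_out_in clA) hu hv].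
    - by split=> h; [case: (side_out_mixed clA hv hu (C_swap clA h)) | case: (side_out_mixed clB hv' hu' (C_swap clB h))].
    - by split; [move/(side_out_mixed clA hu hv) | move/(side_out_mixed clB hu' hv')].
    by rewrite (side_out_out clA hu hv) (side_out_out clB hu' hv').
  have C2 u v : u \in p -> v \in p -> (C u.1 a v.1 <-> C' u.2 b v.2).
    move=> up vp; have [_ _ cy] := pp _ _ _ up yp vp.
    case: (sideb u up) => -[hu hu'].
      split=> [/(side_below clA hu)|/(side_below clB hu')] []; first exact: side.
      by case: (sideb v vp) => -[? ?]; [left | right].
    case: (sideb v vp) => -[hv hv'].
      by split=> _; [apply: (side_mixed clB) hu' hv' | apply: (side_mixed clA) hu hv].
    by rewrite (side_below_out clA _ hu) (side_below_out clB _ hu').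
  move=> u u' v v' w w'; rewrite !inE.
  move=> /orP[/eqP[-> ->]|up] /orP[/eqP[-> ->]|vp] /orP[/eqP[-> ->]|wp].
  - by split=> //; split; [case=> _ [] | case=> _ [] | move/(C_neq clA) | move/(C_neq clB)].
  - by split=> //; split; [case=> _ [] | case=> _ [] | move/(C_neq clA) | move/(C_neq clB)].
  - have [[n n'] [l _]] := pair _ vp; split=> //.
    by split; [move/(C_neq' clA) | move/(C_neq' clB)].
  - have [[n n'] [l _]] := pair _ vp; split=> //; exact: (C1 _ _ vp wp).
  - have [[n n'] [_ l]] := pair _ up; split=> //; first by split=> /esym.
    by split=> _; [apply: (C_diag clB) | apply: (C_diag clA)] => /esym.
  - have [[n n'] [_ l]] := pair _ up; split=> //; first by split=> /esym.
    exact: (C2 _ _ up wp).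
  - have [e l _] := pp _ _ _ up vp vp; split=> //.
    by have [h h'] := C2 _ _ up vp; split=> c; [apply/(C_swap clB)/h/(C_swap clA) | apply/(C_swap clA)/h'/(C_swap clB)].
  exact: (pp _ _ _ up vp wp).
(* If points branch off above [a], the innermost one, [x], bounds [b] from above; otherwise (C5)
   provides a bound. *)
have [exO|noO] := classic (exists2 x, x \in p & C x.1 a y); last first.
  have [x' xyz] := C_above clB y' z'.
  have [[w1 [c1 [_ [l1 _]]]] [w2 [c2 [_ [l2 _]]]]] := C_dense clB xyz.
  have noside b u : u \in p -> C u.1 a y -> C' u.2 b y' by move=> up h; case: noO; exists u.
  case: (lt_total clA (na _ yp)) => l.
    by exists w1; apply: finish; [by [] | by split | exact: noside].
  exists w2; apply: finish; [by [] | | exact: noside].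
  by split=> h; [case: (lt_asym clA h l) | case: (lt_asym clB h l2)].
have [[x x'] [xp xay xmax]] : exists m, [/\ m \in p, C m.1 a y &
    forall n, n \in p -> C n.1 a y -> ~ C m.1 n.1 y].
  apply: (exists_maximal (R := fun m n => C m.1 n.1 y)) => // [u|v u w /(C_swap clA) h1 /(C_swap clA) h2].
    by move/(C_neq clA).
  exact: (C_swap clA (closer_trans clA h1 h2)).
have xyz : C' x' y' z'.
  have [_ _ h] := pp _ _ _ xp yp zp; apply/h/(C_trans clA (C_swap clA xay)).
  exact: (side_mixed clA xay az).
have [[w1 [c1 [x1 [l1 _]]]] [w2 [c2 [x2 [l2 _]]]]] := C_dense clB xyz.
have sideO b : C' x' y' b -> forall u, u \in p -> C u.1 a y -> C' u.2 b y'.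
  move=> xyb u up uay; case: (C_cut clB u.2 xyb) => [h|/(C_swap clB) //].
  case: (xmax _ up uay); have [_ _ e] := pp _ _ _ xp up yp; apply/e.
  exact: (C_trans clB h (C_swap clB xyb)).
case: (lt_total clA (na _ yp)) => l.
  by exists w1; apply: finish; [by [] | by split | exact: sideO].
exists w2; apply: finish; [by [] | | exact: sideO].
by split=> h; [case: (lt_asym clA h l) | case: (lt_asym clB h l2)].
Qed.
End Forth.

Lemma cl_back_and_forth (A B : countType) C le C' le' (p0 : seq (A * B)) :
  CL_structure C le -> CL_structure C' le' -> inhabited A -> inhabited B ->
  cl_piso C le C' le' p0 -> exists phi : A -> B, [/\ bijective phi,
    forall a b, (a, b) \in p0 -> phi a = b,
    forall x y, lt le x y <-> lt le' (phi x) (phi y) &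
    forall x y z, C x y z <-> C' (phi x) (phi y) (phi z)].
Proof.
move=> clA clB iA iB p0P.
have [||p a b a' b' pP i i'|phi [bij ext fin]] := @back_and_forth A B (cl_piso C le C' le') _ _ _ _ p0P.
- by move=> p pP; apply: cl_forth.
- move=> p /cl_piso_swap pP b; have [a /cl_piso_swap h] := cl_forth clB clA iA pP b.
  by exists a; move: h; rewrite /= -map_comp (eq_map (g := id)) ?map_id // => -[].
- by have [] := pP _ _ _ _ _ _ i i' i'.
exists phi; split=> // [x y|x y z].
  by have [p pP /(_ _ _) h] := fin [:: x; y]; have [] := pP _ _ _ _ _ _ (h x _) (h y _) (h y _); rewrite ?inE ?eqxx ?orbT.
by have [p pP /(_ _ _) h] := fin [:: x; y; z]; have [] := pP _ _ _ _ _ _ (h x _) (h y _) (h z _); rewrite ?inE ?eqxx ?orbT.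
Qed.

(** * The hypergraph of a C-relation *)

Section Triples.
Variable K : choiceType.
Implicit Types (x y z : K) (S : {fset K}).

Lemma fset3_swapl x y z : [fset x; y; z] = [fset y; x; z].
Proof. by rewrite [[fset x; y]]fsetUC. Qed.

Lemma fset3_swapr x y z : [fset x; y; z] = [fset x; z; y].
Proof. by rewrite -!fsetUA [[fset y; z]]fsetUC. Qed.

Lemma cardfs3 x y z : x <> y -> y <> z -> x <> z -> #|` [fset x; y; z]| = 3.
Proof.
move=> /eqP xy /eqP yz /eqP xz.
by rewrite fsetUC cardfsU1 cardfs2 xy !inE negb_or ![z == _]eq_sym xz yz.
Qed.

Lemma cardfs3P S : #|` S| = 3 ->
  exists x y z, [/\ S = [fset x; y; z], x <> y, y <> z & x <> z].
Proof.
move=> S3; have eS u : (u \in S) = (u \in enum_fset S) by [].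
case: (enum_fset S) (fset_uniq S) (S3 : size (enum_fset S) = 3) eS => [|x [|y [|z []]]] //=.
rewrite !inE negb_or => /andP[/andP[/eqP xy /eqP xz] /andP[/eqP yz _]] _ eS.
by exists x, y, z; split=> //; apply/fsetP=> u; rewrite eS !inE orbA.
Qed.

Lemma imfset3 (K' : choiceType) (f : K -> K') x y z :
  f @` [fset x; y; z] = [fset f x; f y; f z].
Proof. by rewrite !imfsetU !imfset_fset1. Qed.

End Triples.

Section M3.
Variables (M : countType) (C : M -> M -> M -> Prop) (le : M -> M -> Prop).
Hypothesis clM : CL_structure C le.
Local Notation lt := (lt le).
Local Notation E := (M3_edge C le).

Lemma M3_hyper3 : hyper3 E.
Proof. by move=> S [x [y [z [-> xy yz xz _]]]]; apply: cardfs3. Qed.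

Lemma M3_edgeP x y z : lt x y -> lt x z -> y <> z -> E [fset x; y; z] <-> C x y z.
Proof.
move=> xy xz yz; split=> [[a [b [c [e nab nbc nac [ab ac abc]]]]]|]; last first.
  by move=> h; exists x, y, z; split=> //; [exact: lt_neq xy | exact: lt_neq xz].
have mem u : u \in [fset a; b; c] -> u = x \/ u = y \/ u = z.
  by rewrite -e !inE -orbA => /or3P[/eqP->|/eqP->|/eqP->]; auto.
have min u : u \in [fset a; b; c] -> lt u x -> False.
  by case/mem=> [->|[->|->]]; [exact: lt_irr | move/(lt_asym clM xy) | move/(lt_asym clM xz)].
have ax : a = x.
  have : x \in [fset a; b; c] by rewrite -e !inE eqxx.
  rewrite !inE -orbA => /or3P[/eqP//|/eqP xb|/eqP xc].
    by case: (min a); rewrite ?xb // !inE eqxx.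
  by case: (min a); rewrite ?xc // !inE eqxx.
have hb : b = y \/ b = z.
  case: (mem b); rewrite ?inE ?eqxx ?orbT // => bx; by case: nab; rewrite ax bx.
have hc : c = y \/ c = z.
  case: (mem c); rewrite ?inE ?eqxx ?orbT // => cx; by case: nac; rewrite ax cx.
rewrite -ax; case: hb => hb; case: hc => hc; rewrite hb hc in abc nbc *; try by [].
exact: (C_swap clM abc).
Qed.

(** By compatibility and (C2) exactly one end of an ordered triple splits off, so reversing the
    order exchanges edges and non-edges. *)
Lemma M3_nonedgeP x y z : lt x z -> lt y z -> x <> y -> E [fset x; y; z] <-> ~ C z x y.
Proof.
have main u v w : lt u v -> lt v w -> E [fset u; v; w] <-> ~ C w u v.
  move=> uv vw; have uw := lt_trans clM uv vw.
  rewrite (M3_edgeP uv uw (lt_neq vw)); split; first by move=> h /(C_asym' clM h).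
  by case: (lt_C clM uv vw).
move=> xz yz xy; case: (lt_total clM xy) => l; first exact: main.
by rewrite fset3_swapl (main _ _ _ l xz); split=> h /(C_swap clM).
Qed.

Lemma sorted3 S : #|` S| = 3 -> exists x y z, [/\ S = [fset x; y; z], lt x y & lt y z].
Proof.
have main x y z : lt x y -> y <> z -> x <> z ->
    exists u v w, [/\ [fset x; y; z] = [fset u; v; w], lt u v & lt v w].
  move=> xy nyz nxz; case: (lt_total clM nyz) => l; first by exists x, y, z.
  rewrite fset3_swapr; case: (lt_total clM nxz) => l'; first by exists x, z, y.
  by rewrite fset3_swapl; exists z, x, y.
case/cardfs3P=> x [y [z [-> xy yz xz]]]; case: (lt_total clM xy) => l; first exact: main.
by rewrite fset3_swapl; apply: main.
Qed.

(** * Root splittings and isomorphisms of finite subhypergraphs *)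

Definition cl_split (U : {fset M}) (L R : {fset M}) : Prop :=
  [/\ U = L `|` R, forall x y, x \in L -> y \in R -> lt x y,
      forall x x' y, x \in L -> x' \in L -> y \in R -> C y x x' &
      forall x y y', x \in L -> y \in R -> y' \in R -> C x y y'].

(** The least point [m] and the greatest point [w] lie in different branches at the root of the tree
    spanned by [U], and compatibility groups each point between them with one of the two. The parts
    are the cone of [m] at [w] and the cone of [w] at [m]. *)
Lemma root_split U a b : a \in U -> b \in U -> a <> b ->
  exists L R, [/\ cl_split U L R, L != fset0 & R != fset0].
Proof.
move=> aU bU ab.
have [m [mU _ mmin]] : exists m, [/\ m \in enum_fset U, True & forall n, n \in enum_fset U -> True -> ~ lt n m].
  apply: (exists_maximal (R := fun x y => lt y x)); [exact: lt_irr | | by exists a].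
  by move=> y x z h1 h2; exact: (lt_trans clM h2 h1).
have [w [wU _ wmax]] : exists m, [/\ m \in enum_fset U, True & forall n, n \in enum_fset U -> True -> ~ lt m n].
  apply: (exists_maximal (R := lt)); [exact: lt_irr | | by exists a].
  by move=> y x z h1 h2; exact: (lt_trans clM h1 h2).
have minP u : u \in U -> u <> m -> lt m u.
  by move=> uU /(lt_total clM) [/(mmin u uU I)|].
have maxP u : u \in U -> u <> w -> lt u w.
  by move=> uU /(lt_total clM) [|/(wmax u uU I)].
have mw : m <> w.
  move=> e; case: ab; have allm u : u \in U -> u = m.
    by move=> uU; apply: NNPP => n; apply: (wmax u uU I); rewrite -e; apply: minP.
  by rewrite (allm a aU) (allm b bU).
have LR x y x' : C w m x -> C m w y -> C w m x' -> C y x x'.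
  move=> hx hy hx'.
  have aux u : C w m u -> C y m u.
    move=> h; case: (C_cut clM y h) => // h1.
    by case: (C_asym clM (C_swap clM (C_trans clM h1 (C_swap clM h))) hy).
  exact: (C_trans clM (C_swap clM (aux _ hx)) (aux _ hx')).

have RL x y y' : C w m x -> C m w y -> C m w y' -> C x y y'.
  move=> hx hy hy'.
  have aux u : C m w u -> C x w u.
    move=> h; case: (C_cut clM x h) => // h1.
    by case: (C_asym clM (C_swap clM (C_trans clM h1 (C_swap clM h))) hx).
  exact: (C_trans clM (C_swap clM (aux _ hy)) (aux _ hy')).
exists [fset u in U | asbool (C w m u)], [fset u in U | asbool (C m w u)]; split.
- split.
  + apply/fsetP=> u; rewrite !inE; case: (boolP (u \in U)) => //= uU; apply/esym/orP.
    have [->|um] := classic (u = m); first by left; apply/asboolP; apply: (C_diag clM) => /esym.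
    have [->|uw] := classic (u = w); first by right; apply/asboolP; apply: (C_diag clM).
    case: (lt_C clM (minP u uU um) (maxP u uU uw)) => [/(C_swap clM) h|h]; [right | left]; exact/asboolP.
  + move=> x y; rewrite !inE => /andP[xU /asboolP xL] /andP[yU /asboolP yR].
    have ym : y <> m by move/esym; exact: (C_neq' clM yR).
    exact: (C_gt clM (LR m y x (C_diag clM (not_eq_sym mw)) yR xL) (minP y yU ym)).
  + move=> x x' y; rewrite !inE => /andP[xU /asboolP xL] /andP[_ /asboolP x'L] /andP[yU /asboolP yR].
    exact: LR.
  + move=> x y y'; rewrite !inE => /andP[xU /asboolP xL] /andP[_ /asboolP yR] /andP[_ /asboolP y'R].
    exact: RL.
- by apply/fset0Pn; exists m; rewrite !inE mU; apply/asboolP; apply: (C_diag clM) => /esym.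
- by apply/fset0Pn; exists w; rewrite !inE wU; apply/asboolP; apply: (C_diag clM).
Qed.

Definition e_iso (f : M -> M) (U : {fset M}) : Prop :=
  {in U &, injective f} /\ forall x y z, x \in U -> y \in U -> z \in U ->
    x <> y -> y <> z -> x <> z -> (E [fset x; y; z] <-> E [fset f x; f y; f z]).

(** Implications in one direction are asked for; [lt_total] and [C_total] yield the converses in
    [cl_mono_piso]. *)
Definition cl_mono (h : M -> M) (U : {fset M}) : Prop :=
  (forall x y, x \in U -> y \in U -> lt x y -> lt (h x) (h y)) /\
  (forall x y z, x \in U -> y \in U -> z \in U -> C x y z -> C (h x) (h y) (h z)).

Lemma split_nonedge U L R x x' y : cl_split U L R ->
  x \in L -> x' \in L -> y \in R -> x <> x' -> ~ E [fset x; x'; y].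
Proof.
move=> [_ lt_LR C_L _] xL x'L yR n /(M3_nonedgeP (lt_LR _ _ xL yR) (lt_LR _ _ x'L yR) n).
by apply; apply: C_L.
Qed.

Lemma split_edge U L R x y y' : cl_split U L R ->
  x \in L -> y \in R -> y' \in R -> y <> y' -> E [fset x; y; y'].
Proof.
move=> [_ lt_LR _ C_R] xL yR y'R n.
by apply/(M3_edgeP (lt_LR _ _ xL yR) (lt_LR _ _ xL y'R) n); apply: C_R.
Qed.

(** The root alone decides pairs and triples that meet both parts, so maps respecting the parts can
    be chosen independently on each. *)
Lemma cl_mono_glue U L R L' R' W hL hR : cl_split U L R -> cl_split W L' R' ->
  cl_mono hL L -> cl_mono hR R ->
  (forall x, x \in L -> hL x \in L') -> (forall x, x \in R -> hR x \in R') ->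
  cl_mono (fun x => if x \in L then hL x else hR x) U.
Proof.
move=> [eU ltLR CL CR] [_ ltLR' CL' CR'] [lL cL] [lR cR] hLL hRR.
have RL x : x \in U -> (x \in L) = false -> x \in R by rewrite eU inE => /orP[->|].
split=> [x y xU yU|x y z xU yU zU].
  case xL: (x \in L); case yL: (y \in L); first exact: lL.
  - by move=> _; apply: ltLR'; [apply: hLL | apply/hRR/RL].
  - by move/(lt_asym clM (ltLR _ _ yL (RL _ xU xL))).
  by apply: lR; apply: RL.
case xL: (x \in L); case yL: (y \in L); case zL: (z \in L) => h.
- exact: cL.
- by case: (C_asym' clM h (CL _ _ _ xL yL (RL _ zU zL))).
- by case: (C_asym clM h (CL _ _ _ xL zL (RL _ yU yL))).
- by apply: CR'; [apply: hLL | apply/hRR/RL..].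
- by apply: CL'; [apply: hLL.. | apply/hRR/RL].
- by case: (C_asym clM h (CR _ _ _ yL (RL _ xU xL) (RL _ zU zL))).
- by case: (C_asym' clM h (CR _ _ _ zL (RL _ xU xL) (RL _ yU yL))).
by apply: cR => //; apply: RL.
Qed.

(* Two splittings of the same hypergraph can only differ by exchanging a point
   [b] of the left part with a point [c] of the right part, and then [b] and
   [c] are twins: the transposition [(b c)] preserves the hypergraph. *)
Lemma split_align U L R f W L' R' : e_iso f U -> W = f @` U ->
  cl_split U L R -> cl_split W L' R' -> L != fset0 -> R != fset0 -> L' != fset0 -> R' != fset0 ->
  exists f', [/\ e_iso f' U, f' @` U = W, forall x, x \in L -> f' x \in L' &
    forall x, x \in R -> f' x \in R'].
Proof.
move=> [finj fE] eW sp sp' nL nR nL' nR'.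
have [eU _ _ _] := sp; have [eW' ltLR' _ _] := sp'.
have LU x : x \in L -> x \in U by rewrite eU inE => ->.
have RU x : x \in R -> x \in U by rewrite eU inE orbC => ->.
have fW x : x \in U -> f x \in L' \/ f x \in R'.
  by move=> xU; apply/orP; rewrite -in_fsetU -eW' eW; apply/imfsetP; exists x.
have LRdisj x y : x \in L -> y \in R -> x <> y.
  by move=> xL yR; apply: (lt_neq (le := le)); case: sp => _ h _ _; apply: h.
have LRdisj' x y : f x \in L' -> f y \in R' -> x <> y.
  by move=> xL yR e; move: (lt_neq (ltLR' _ _ xL yR)); rewrite e.
have nonedge' x y z : x \in U -> y \in U -> z \in U -> f x \in L' -> f y \in L' -> f z \in R' ->
    x <> y -> ~ E [fset x; y; z].
  move=> xU yU zU fx fy fz xy; have [xz yz] := (LRdisj' _ _ fx fz, LRdisj' _ _ fy fz).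
  rewrite (fE x y z) //; apply: (split_nonedge sp') => // /finj e; exact: xy (e xU yU).
have edge' x y z : x \in U -> y \in U -> z \in U -> f x \in L' -> f y \in R' -> f z \in R' ->
    y <> z -> E [fset x; y; z].
  move=> xU yU zU fx fy fz yz; have [xz xy] := (LRdisj' _ _ fx fz, LRdisj' _ _ fx fy).
  rewrite (fE x y z) //; apply: (split_edge sp') => // /finj e; exact: yz (e yU zU).
have exL' : exists2 x, x \in U & f x \in L'.
  have /fset0Pn[u uL'] := nL'; have : u \in W by rewrite eW' inE uL'.
  by rewrite eW => /imfsetP[x /= xU e]; exists x; rewrite -?e.
have exR' : exists2 x, x \in U & f x \in R'.
  have /fset0Pn[u uL'] := nR'; have : u \in W by rewrite eW' inE uL' orbT.
  by rewrite eW => /imfsetP[x /= xU e]; exists x; rewrite -?e.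
have [[b bL bR']|nB] := classic (exists2 b, b \in L & f b \in R').
  (* Without such a [c], the points [a], [b] and [d] below would form a non-edge for the first
     splitting and an edge for the second. *)
  have [[c cR cL']|nC] := classic (exists2 c, c \in R & f c \in L'); last first.
    have [a aU aL'] := exL'; have /fset0Pn[d dR] := nR.
    have aL : a \in L by move: aU; rewrite eU inE => /orP[//|aR]; case: nC; exists a.
    have dR' : f d \in R' by case: (fW d (RU d dR)) => // dL'; case: nC; exists d.
    case: (split_nonedge sp aL bL dR (LRdisj' _ _ aL' bR')).
    by apply: edge' => //; [exact: LU | exact: RU | exact: LRdisj].
  have bU := LU b bL; have cU := RU c cR; have bc := LRdisj _ _ bL cR.
  have uniqb x : x \in L -> f x \in R' -> x = b.
    move=> xL xR'; apply: NNPP => xb; case: (split_nonedge sp xL bL cR xb).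
    by rewrite fset3_swapr fset3_swapl; apply: edge' => //; exact: LU.
  have uniqc x : x \in R -> f x \in L' -> x = c.
    move=> xR xL'; apply: NNPP => xc; case: (nonedge' x c b) => //; first exact: RU.
    by rewrite fset3_swapr fset3_swapl; apply: (split_edge sp) => //.
  have other x : x \in U -> x <> b -> x <> c -> (x \in L /\ f x \in L') \/ (x \in R /\ f x \in R').
    move=> xU xb xc; case: (fW x xU) => fx; move: (xU); rewrite eU inE => /orP[xL|xR]; auto.
      by case: xc; apply: uniqc.
    by case: xb; apply: uniqb.
  have twin x y : x \in U -> y \in U -> x <> b -> x <> c -> y <> b -> y <> c -> x <> y ->
      E [fset b; x; y] <-> E [fset c; x; y].
    move=> xU yU xb xc yb yc xy.
    case: (other x xU xb xc) => -[xS xS']; case: (other y yU yb yc) => -[yS yS'].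
    - split=> h; first by case: (nonedge' x y b) => //; rewrite fset3_swapr fset3_swapl.
      by case: (split_nonedge sp xS yS cR xy); rewrite fset3_swapr fset3_swapl.
    - split=> h; first by case: (split_nonedge sp bL xS yS) => //; exact: not_eq_sym.
      by case: (nonedge' c x y) => //; exact: not_eq_sym.
    - split=> h; first by case: (split_nonedge sp bL yS xS); [exact: not_eq_sym | rewrite fset3_swapr].
      by case: (nonedge' c y x) => //; [exact: not_eq_sym | rewrite fset3_swapr].
    by split=> _; [apply: edge' | apply: (split_edge sp)].
  pose t x := if x == b then c else if x == c then b else x.
  have tb : t b = c by rewrite /t eqxx.
  have tc : t c = b by rewrite /t eqxx; case: eqP => // /esym.
  have tn x : x <> b -> x <> c -> t x = x by rewrite /t => /eqP/negbTE-> /eqP/negbTE->.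
  have tcase x : [\/ x = b, x = c | x <> b /\ x <> c].
    by case: (eqVneq x b) => [|/eqP]; case: (eqVneq x c) => [|/eqP]; [constructor 1 | constructor 1 | constructor 2 | constructor 3].
  have tK : involutive t.
    by move=> x; case: (tcase x) => [->|->|[n n']]; rewrite ?tb ?tc ?tb // !tn.
  have tU x : x \in U -> t x \in U.
    by move=> xU; case: (tcase x) => [->|->|[n n']]; rewrite ?tb ?tc ?tn.
  have tinj := inv_inj tK.
  have tE1 x y z : x = b \/ x = c -> x \in U -> y \in U -> z \in U -> x <> y -> y <> z -> x <> z ->
      E [fset x; y; z] -> E [fset t x; t y; t z].
    move=> xbc xU yU zU xy yz xz.
    case: (tcase y) => [yb|yc|[yb yc]]; case: (tcase z) => [zb|zc|[zb zc]]; case: xbc => e;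
      try congruence; rewrite ?e ?yb ?yc ?zb ?zc ?tb ?tc ?(tn y) ?(tn z) //.
    - by rewrite fset3_swapl.
    - by rewrite fset3_swapl.
    - by rewrite fset3_swapr fset3_swapl fset3_swapr.
    - by rewrite fset3_swapr fset3_swapl fset3_swapr.
    - by move/twin; apply.
    by rewrite twin.
  have tE x y z : x \in U -> y \in U -> z \in U -> x <> y -> y <> z -> x <> z ->
      E [fset x; y; z] -> E [fset t x; t y; t z].
    move=> xU yU zU xy yz xz.
    case: (tcase x) => [xb|xc|[xb xc]]; [by apply: tE1; auto | by apply: tE1; auto | ].
    case: (tcase y) => [yb|yc|[yb yc]].
    - by rewrite fset3_swapl [in X in _ -> X]fset3_swapl; apply: tE1; auto.
    - by rewrite fset3_swapl [in X in _ -> X]fset3_swapl; apply: tE1; auto.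
    have perm u v w : [fset u; v; w] = [fset w; u; v] :> {fset M} by rewrite fset3_swapr fset3_swapl.
    case: (tcase z) => [zb|zc|[zb zc]]; last by rewrite !tn.
    - by rewrite perm [in X in _ -> X]perm; apply: tE1; auto.
    by rewrite perm [in X in _ -> X]perm; apply: tE1; auto.
  exists (f \o t); split.
  - split=> [x y xU yU /= /finj e|x y z xU yU zU xy yz xz]; first by apply: tinj; apply: e; apply: tU.
    rewrite /= -fE; try by [exact: tU | move/tinj].
    by split; [exact: tE | move=> h; rewrite -(tK x) -(tK y) -(tK z); apply: tE => //; by [exact: tU | move/tinj]].
  - rewrite eW; apply/fsetP=> u; apply/imfsetP/imfsetP => -[x /= xU ->]; first by exists (t x); rewrite // tU.
    by exists (t x); rewrite /= ?tU ?tK.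
  - move=> x xL /=; case: (tcase x) => [->|e|[n n']]; first by rewrite tb.
      by case: (LRdisj _ _ xL cR).
    by rewrite tn //; case: (other x (LU x xL) n n') => [[]//|[xR _]]; case: (LRdisj _ _ xL xR).
  move=> x xR /=; case: (tcase x) => [e|->|[n n']]; first by case: (LRdisj _ _ bL xR).
    by rewrite tc.
  by rewrite tn //; case: (other x (RU x xR) n n') => [[xL _]|[]//]; case: (LRdisj _ _ xL xR).
have LL' x : x \in L -> f x \in L'.
  by move=> xL; case: (fW x (LU x xL)) => // xR'; case: nB; exists x.
exists f; split=> // x xR; case: (fW x (RU x xR)) => // xL'.
(* Now [a], [x] and [d] form an edge for the first splitting; were [x] sent to [L'], they would be a
   non-edge for the second. *)
have /fset0Pn[a aL] := nL; have [d dU dR'] := exR'.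
have dR : d \in R by move: dU; rewrite eU inE => /orP[dL|//]; case: nB; exists d.
case: (nonedge' a x d) => //; try by [exact: LU | exact: RU | exact: LL' | exact: LRdisj].
by apply: (split_edge sp) => //; exact: LRdisj' dR'.
Qed.

(** Only the image of [f] is kept, since [f] itself may reverse the order of twins. Once the root
    splittings of [U] and of its image are aligned, the two parts are smaller instances. *)
Lemma e_iso_cl_mono n (U : {fset M}) f : #|` U| <= n -> e_iso f U ->
  exists2 h, cl_mono h U & h @` U = f @` U.
Proof.
elim: n U f => [|n IH] U f Un fU.
  have -> : U = fset0 by apply/eqP; rewrite -cardfs_eq0 -leqn0.
  by exists f => //; split=> [x y|x y z]; rewrite inE.
have [triv|] := classic (forall a b, a \in U -> b \in U -> a = b).
  exists f => //; split=> [x y xU yU [_ []]|x y z xU yU zU h]; [exact: triv | case: (C_neq clM h); exact: triv].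
move/not_all_ex_not=> [a /not_all_ex_not [b nab]].
have [aU [bU ab]] : a \in U /\ b \in U /\ a <> b.
  split; first by apply: NNPP => h; case: nab => /h.
  by split=> [|e]; [apply: NNPP => h; case: nab => _ /h | case: nab].
have [L [R [sp nL nR]]] := root_split aU bU ab.
have [finj fE] := fU.
have [L' [R' [sp' nL' nR']]] : exists L' R', [/\ cl_split (f @` U) L' R', L' != fset0 & R' != fset0].
  apply: (@root_split _ (f a) (f b)); [exact: in_imfset | exact: in_imfset |].
  by move/finj=> e; apply: ab; apply: e.
have [f' [[f'inj f'E] eW fL fR]] := split_align fU erefl sp sp' nL nR nL' nR'.
have [eU ltLR _ _] := sp; have [eW' _ _ _] := sp'.
have LU x : x \in L -> x \in U by rewrite eU inE => ->.
have RU x : x \in R -> x \in U by rewrite eU inE orbC => ->.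
have sub S : S `<=` U -> e_iso f' S.
  move=> /fsubsetP SU; split=> [x y xS yS|x y z xS yS zS]; first by apply: f'inj; apply: SU.
  by apply: f'E; apply: SU.
have dis : [disjoint L & R]%fset.
  by apply/fdisjointP=> x xL; apply/negP=> /(ltLR _ _ xL) [_ []].
have cU : #|` U| = (#|` L| + #|` R|)%N by rewrite eU cardfsU (eqP dis) cardfs0 subn0.
have L0 : 0 < #|` L| by rewrite cardfs_gt0.
have R0 : 0 < #|` R| by rewrite cardfs_gt0.
have [||hL hLm hLe] := IH L f'.
- by rewrite -ltnS; apply: leq_trans Un; rewrite cU -addn1 leq_add2l.
- by apply: sub; apply/fsubsetP.
have [||hR hRm hRe] := IH R f'.
- by rewrite -ltnS; apply: leq_trans Un; rewrite cU -add1n leq_add2r.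
- by apply: sub; apply/fsubsetP.
have hLL x : x \in L -> hL x \in L'.
  move=> xL; have : hL x \in hL @` L by apply: in_imfset.
  by rewrite hLe => /imfsetP[y /= yL ->]; apply: fL.
have hRR x : x \in R -> hR x \in R'.
  move=> xR; have : hR x \in hR @` R by apply: in_imfset.
  by rewrite hRe => /imfsetP[y /= yR ->]; apply: fR.
exists (fun x => if x \in L then hL x else hR x); first exact: cl_mono_glue sp sp' hLm hRm hLL hRR.
rewrite -eW eU !imfsetU -hLe -hRe; congr (_ `|` _); apply: eq_in_imfset => // x /= xS; rewrite ?xS //.
by case: ifP => // xL; case: (ltLR _ _ xL xS) => _ [].
Qed.

End M3.

(** * Homogeneity properties of M_3 *)

Lemma M3_iso (A B : countType) C le C' le' (phi : A -> B) :
  CL_structure C le -> CL_structure C' le' ->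
  (forall x y, lt le x y <-> lt le' (phi x) (phi y)) ->
  (forall x y z, C x y z <-> C' (phi x) (phi y) (phi z)) ->
  forall S, #|` S| = 3 -> (M3_edge C le S <-> M3_edge C' le' (phi @` S)).
Proof.
move=> clA clB ltP CP S /(sorted3 clA) [x [y [z [-> xy yz]]]].
have xz := lt_trans clA xy yz.
rewrite imfset3 (M3_edgeP clA xy xz (lt_neq yz)) CP.
by rewrite -(M3_edgeP clB) //; [apply/ltP | apply/ltP | apply/(lt_neq (le := le'))/ltP].
Qed.

Lemma cl_mono_piso (M : countType) C le (h : M -> M) (U : {fset M}) : CL_structure C le ->
  cl_mono C le h U -> cl_piso C le C le [seq (x, h x) | x <- enum_fset U].
Proof.
move=> clM [hlt hC] x x' y y' z z'.
move=> /mapP[u uU [-> ->]] /mapP[v vU [-> ->]] /mapP[w wU [-> ->]] {x x' y y' z z'}.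
have inj a b : a \in U -> b \in U -> h a = h b -> a = b.
  move=> aU bU e; apply: NNPP => /(lt_total clM) [] l; have := hlt _ _ _ _ l; rewrite e.
    by case/(_ aU bU) => _ [].
  by case/(_ bU aU) => _ [].
split; first by split=> [->|/inj]; auto.
  split=> [|l]; first exact: hlt.
  have [/(lt_total clM)[]|e] := classic (u <> v) => //.
    by move/(hlt _ _ vU uU)/(lt_asym clM l).
  by case: (lt_neq l); congr h; apply: NNPP.
split=> [|c]; first exact: hC.
have uv : u <> v by move=> e; apply: (C_neq clM c); rewrite e.
have uw : u <> w by move=> e; apply: (C_neq' clM c); rewrite e.
have [<-|vw] := classic (v = w); first exact: (C_diag clM).
case: (C_total clM uv vw uw) => [//|[/hC c'|/hC c']].
  by case: (C_asym clM c (c' _ _ _)).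
by case: (C_asym' clM c (c' _ _ _)).
Qed.

Section M3Main.
Variables (M : countType) (C : M -> M -> M -> Prop) (le : M -> M -> Prop).
Hypotheses (clM : CL_structure C le) (infM : countably_infinite M).
Local Notation lt := (lt le).
Local Notation E := (M3_edge C le).

Lemma M3_set_hom : set_hom E.
Proof.
move=> t _ U W _ _ [f [[finj fE] eW]].
have fU : e_iso C le f U.
  split=> // x y z xU yU zU xy yz xz; rewrite -imfset3; apply: fE; last exact: cardfs3.
  by apply/fsubsetP=> u; rewrite !inE -orbA => /or3P[/eqP->|/eqP->|/eqP->].
have [h hm he] := e_iso_cl_mono clM (leqnn _) fU.
have [x0 _] := infM [::].
have [g [gbij gext glt gC]] := cl_back_and_forth clM clM (inhabits x0) (inhabits x0) (cl_mono_piso clM hm).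
exists g; split; first by split=> //; apply: M3_iso.
rewrite -eW -he; apply: eq_in_imfset => // x /= xU.
by apply: gext; apply: map_f.
Qed.

(* The right-hand side says that [x, w, y, z] form the tree (xw)(yz). *)
Lemma M3_lt_def x y : x <> y -> (lt x y <-> exists w z,
  [/\ [/\ x <> w, x <> z, y <> w, y <> z & w <> z],
      ~ E [fset x; w; y], ~ E [fset x; w; z], E [fset x; y; z] & E [fset w; y; z]]).
Proof.
move=> nxy; split=> [xy|[w [z [[xw xz yw yz wz] n1 n2 e1 e2]]]].
  (* By (C6), [w] is taken in the cone of [x] at [y], and [z] in the cone of [y] at [x]. *)
  have [w [xw yxw]] := C_below clM (not_eq_sym nxy).
  have [z [yz xyz]] := C_below clM nxy.
  have yw := C_neq' clM yxw; have nxz := C_neq' clM xyz.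
  have wz : w <> z by move=> e; apply: (C_asym clM xyz); rewrite -e.
  have xz := C_lt clM xyz xy; have wy := C_gt clM yxw xy.
  have wyz : C w y z.
    case: (C_cut clM w xyz) => // h.
    by case: (C_asym clM (C_swap clM (C_trans clM h (C_swap clM xyz))) yxw).
  have zxw : C z x w by case: (C_cut clM z yxw) => // h; case: (C_asym' clM h wyz).
  have lwz := C_lt clM wyz wy.
  exists w, z; split=> //; first by apply/(M3_nonedgeP clM xy wy xw); apply.
  - by apply/(M3_nonedgeP clM xz lwz xw); apply.
  - exact/(M3_edgeP clM xy xz yz).
  exact/(M3_edgeP clM wy lwz yz).
case: (lt_total clM nxy) => // yx; exfalso.
(* If [y] precedes [x], the least of the four points is [w], [y] or [z]; each choice contradicts the
   prescribed edges. *)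
have wmin : lt w y -> lt w z -> False.
  move=> wy lwz; have wx := lt_trans clM wy yx.
  have wyz := (M3_edgeP clM wy lwz yz).1 e2.
  case: (C_cut clM x wyz) => [h|xyz].
    by apply: n2; rewrite fset3_swapl; apply/(M3_edgeP clM wx lwz xz).
  have zx := C_gt clM xyz yx.
  by move: e1; rewrite fset3_swapl fset3_swapr => /(M3_nonedgeP clM yx zx yz); apply.
case: (lt_total clM yz) => [lyz|lzy]; [case: (lt_total clM yw) => l | case: (lt_total clM wz) => l].
- have ywz := (M3_edgeP clM l lyz wz).1; rewrite fset3_swapl in e2.
  have yxz := (M3_edgeP clM yx lyz xz).1; rewrite fset3_swapl in e1.
  apply: n1; rewrite fset3_swapr fset3_swapl; apply/(M3_edgeP clM yx l xw).
  exact: (C_trans clM (yxz e1) (C_swap clM (ywz e2))).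
- exact: wmin l (lt_trans clM l lyz).
- exact: wmin (lt_trans clM l lzy) l.
have lzx := lt_trans clM lzy yx.
have zxy := (M3_edgeP clM lzx lzy nxy).1; rewrite fset3_swapr fset3_swapl in e1.
have zwy := (M3_edgeP clM l lzy (not_eq_sym yw)).1; rewrite fset3_swapr fset3_swapl in e2.
apply: n2; rewrite fset3_swapr fset3_swapl; apply/(M3_edgeP clM lzx l xw).
exact: (C_trans clM (zxy e1) (C_swap clM (zwy e2))).
Qed.

Lemma M3_aut_lt g x y : is_aut E g -> lt x y -> lt (g x) (g y).
Proof.
move=> [/bij_inj ginj gE] xy; have nxy := lt_neq xy.
have gn u v : u <> v -> g u <> g v by move=> uv /ginj.
have ge u v w : u <> v -> v <> w -> u <> w -> (E [fset u; v; w] <-> E [fset g u; g v; g w]).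
  by move=> uv vw uw; rewrite -imfset3; apply/gE/cardfs3.
have [w [z [[xw xz yw yz wz] n1 n2 e1 e2]]] := (M3_lt_def nxy).1 xy.
have wy := not_eq_sym yw.
apply/(M3_lt_def (gn _ _ nxy)); exists (g w), (g z).
split; first by split; apply: gn.
- by rewrite -ge.
- by rewrite -ge.
- by rewrite -ge.
by rewrite -ge.
Qed.

Lemma M3_two_points : exists a b, lt a b.
Proof.
have [x _] := infM [::]; have [y] := infM [:: x]; rewrite inE => /eqP/(lt_total clM) [] l; by [exists x, y | exists y, x].
Qed.

Lemma M3_not_two_transitive : ~ two_transitive E.
Proof.
have [a [b ab]] := M3_two_points.
move=> /(_ a b b a (lt_neq ab) (not_eq_sym (lt_neq ab))) [g [gaut [ga gb]]].
by move: (M3_aut_lt gaut ab); rewrite ga gb => /(lt_asym clM ab).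
Qed.

Lemma M3_not_homogeneous : ~ homogeneous E.
Proof.
have [a [b ab]] := M3_two_points; have nab := lt_neq ab.
pose f x := if x == a then b else a.
have fa : f a = b by rewrite /f eqxx.
have fb : f b = a by rewrite /f; case: eqP => // /esym.
move=> /(_ [fset a; b] f) [|g [gaut gf]].
  split=> [x y|S SU S3]; last first.
    by move: (fsubset_leq_card SU); rewrite S3 cardfs2; case: eqP.
  rewrite !inE => /orP[/eqP->|/eqP->] /orP[/eqP->|/eqP->]; rewrite ?fa ?fb //.
move: (M3_aut_lt gaut ab); rewrite !gf ?inE ?eqxx ?orbT // fa fb.
exact: (lt_asym clM ab).
Qed.
End M3Main.

(** * The invariant tournament *)

(** Listing the coloured points first on both sides, the bijection sends each position to the same
    position. It supplies the isomorphisms between hypergraphs on at most four points. *)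
Lemma color_matching (K : eqType) (s s' : seq K) (c c' : pred K) :
  uniq s -> uniq s' -> size s = size s' -> count c s = count c' s' ->
  exists f : K -> K, [/\ {in s &, injective f}, perm_eq (map f s) s' &
    {in s, forall x, c x = c' (f x)}].
Proof.
move=> us us' ss cs.
pose r := filter c s ++ filter (predC c) s.
pose r' := filter c' s' ++ filter (predC c') s'.
have pr : perm_eq r s by rewrite perm_filterC.
have pr' : perm_eq r' s' by rewrite perm_filterC.
have ur : uniq r by rewrite (perm_uniq pr).
have ur' : uniq r' by rewrite (perm_uniq pr').
have sr : size r = size r' by rewrite (perm_size pr) (perm_size pr').
have [s0|[x0 x0s]] : s = [::] \/ exists x, x \in s.
  by case: (s) => [|x t]; [left | right; exists x; rewrite mem_head].
  by exists id; move: ss; rewrite s0 => /esym/size0nil ->.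
pose f x := nth x0 r' (index x r).
have fr : map f r = r'.
  apply: (@eq_from_nth _ x0); rewrite ?size_map // => i ir.
  by rewrite (nth_map x0) // /f index_uniq.
exists f; split.
- move=> x y xs ys /eqP; rewrite nth_uniq -?sr ?index_mem ?(perm_mem pr) //.
  by move=> /eqP /(congr1 (nth x0 r)); rewrite !nth_index ?(perm_mem pr).
- by rewrite (perm_trans _ pr') // -fr; apply: perm_map; rewrite perm_sym.
have sc : size (filter c s) = size (filter c' s') by rewrite !size_filter.
move=> x xs; rewrite /f /r index_cat /r' nth_cat mem_filter xs andbT -sc.
case: (boolP (c x)) => [cx|ncx].
  have xf : x \in filter c s by rewrite mem_filter cx.
  rewrite index_mem xf; have : nth x0 [seq x <- s' | c' x] (index x [seq x <- s | c x]) \in filter c' s'.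
    by rewrite mem_nth // -sc index_mem.
  by rewrite mem_filter => /andP[->].
rewrite ltnNge leq_addr /= addKn.
have xf : x \in filter (predC c) s by rewrite mem_filter /= ncx.
have : nth x0 (filter (predC c') s') (index x (filter (predC c) s)) \in filter (predC c') s'.
  rewrite mem_nth //; move: xf; rewrite -index_mem; congr (_ < _).
  by apply/eqP; rewrite -(eqn_add2l (size (filter c s))) {2}sc -!size_cat (perm_size pr) (perm_size pr') ss.
by rewrite mem_filter /= => /andP[/negbTE->].
Qed.

Section Aut.
Variables (V : countType) (F : {fset V} -> Prop).
Local Notation aut := (is_aut F).

Lemma aut_inj g : aut g -> injective g.
Proof. by case=> /bij_inj. Qed.

Lemma aut_comp g h : aut g -> aut h -> aut (h \o g).
Proof.
move=> [bg gF] [bh hF]; split; first exact: bij_comp.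
move=> S S3; rewrite (gF S S3) (hF (g @` S)); last by rewrite card_imfset //; exact: bij_inj.
by rewrite (imfset_comp _ g h); split.
Qed.

Lemma aut_inv g : aut g -> exists2 h, aut h & cancel g h /\ cancel h g.
Proof.
move=> [[h gK hK] gF]; exists h => //; split; first by exists g.
move=> S S3; rewrite (gF (h @` S)); last by rewrite card_imfset //; exact: can_inj hK.
rewrite -(imfset_comp _ h g).
by have -> : (g \o h) @` S = S by rewrite -[RHS]imfset_id; apply: eq_in_imfset => x _; exact: hK.
Qed.

Hypothesis homF : le_set_hom F 4.

Definition Fs (s : seq V) : bool := asbool (F [fset x in s]).

Lemma eq_Fs s s' : s =i s' -> Fs s = Fs s'.
Proof. by move=> e; congr (asbool (F _)); apply/fsetP=> x; rewrite !inE e. Qed.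

Lemma card_seq (s : seq V) : uniq s -> #|` [fset x in s]| = size s.
Proof. by move=> us; rewrite card_fseq undup_id. Qed.

Lemma imfset_seq (f : V -> V) (s : seq V) : f @` [fset x in s] = [fset x in map f s].
Proof.
apply/fsetP=> y; rewrite inE; apply/imfsetP/mapP => -[x /= xs ->]; exists x => //.
  by move: xs; rewrite inE.
by rewrite inE.
Qed.

Lemma aut_Fs g s : aut g -> uniq s -> size s = 3 -> Fs (map g s) = Fs s.
Proof.
move=> [_ gF] us s3; have := gF [fset x in s]; rewrite card_seq // => /(_ s3).
by rewrite imfset_seq => h; apply/asboolP/asboolP => /h.
Qed.

Lemma aut_of_piso s s' f : uniq s -> uniq s' -> 0 < size s <= 4 ->
  {in s &, injective f} -> perm_eq (map f s) s' ->
  (forall r, uniq r -> {subset r <= s} -> size r = 3 -> Fs r = Fs (map f r)) ->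
  exists2 g, aut g & perm_eq (map g s) s'.
Proof.
move=> us us' s4 finj pf fF.
have ss : size s = size s' by rewrite -(perm_size pf) size_map.
have [||g [ga e]] := homF s4 (card_seq us) (W := [fset x in s']).
- by rewrite card_seq.
- exists f; split; last by rewrite imfset_seq; apply/fsetP=> x; rewrite !inE (perm_mem pf).
  split=> [x y|S SU S3]; first by rewrite !inE; apply: finj.
  have [r [ur r3 eS]] : exists r, [/\ uniq r, size r = 3 & S = [fset x in r]].
    have [x [y [z [-> /eqP xy /eqP yz /eqP xz]]]] := cardfs3P S3; exists [:: x; y; z].
    rewrite /= !inE negb_or xy xz yz; split=> //.
    by apply/fsetP=> u; rewrite !inE orbF orbA.
  rewrite eS imfset_seq; have := fF r ur _ r3; rewrite /Fs => h.
  have sub : {subset r <= s}.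
    by move=> x xr; have /fsubsetP/(_ x) := SU; rewrite eS !inE => ->.
  by split=> /asboolP fr; apply/asboolP; [rewrite -(h sub) | rewrite (h sub)].
exists g => //; apply: uniq_perm => //; first by rewrite map_inj_uniq //; exact: aut_inj ga.
by move=> x; move: e => /fsetP/(_ x); rewrite imfset_seq !inE.
Qed.

Lemma seq_hom2 s s' : uniq s -> uniq s' -> size s = 2 -> size s' = 2 ->
  exists2 g, aut g & perm_eq (map g s) s'.
Proof.
move=> us us' s2 s2'.
have [|//|f [finj pf _]] := color_matching (c := xpred0) (c' := xpred0) us us'.
  by rewrite s2 s2'.
  by rewrite !count_pred0.
apply: (aut_of_piso us us' _ finj pf) => [|r ur rs r3]; first by rewrite s2.
by have := uniq_leq_size ur rs; rewrite r3 s2.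
Qed.

Lemma seq_hom3 s s' : uniq s -> uniq s' -> size s = 3 -> size s' = 3 -> Fs s = Fs s' ->
  exists2 g, aut g & perm_eq (map g s) s'.
Proof.
move=> us us' s3 s3' e.
have [||f [finj pf _]] := color_matching (c := xpred0) (c' := xpred0) us us'.
- by rewrite s3 s3'.
- by rewrite !count_pred0.
apply: (aut_of_piso us us' _ finj pf) => [|r ur rs r3]; first by rewrite s3.
have [|_ mr] := uniq_min_size ur rs; first by rewrite s3 r3.
rewrite (eq_Fs mr) e; apply: eq_Fs => x; rewrite -(perm_mem pf).
by apply/mapP/mapP => -[y yr ->]; exists y => //; [rewrite mr | rewrite -mr].
Qed.

Definition ty (s : seq V) : seq bool := [seq Fs (rem x s) | x <- s].

(** A 3-hypergraph on four points amounts to the set of points whose complement is an edge; any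
    bijection respecting these sets is an isomorphism. *)
Lemma seq_hom4 s s' : uniq s -> uniq s' -> size s = 4 -> size s' = 4 ->
  count id (ty s) = count id (ty s') -> exists2 g, aut g & perm_eq (map g s) s'.
Proof.
move=> us us' s4 s4'; rewrite !count_map => e.
have [||f [finj pf fc]] := color_matching (c := fun x => Fs (rem x s)) (c' := fun x => Fs (rem x s')) us us'.
- by rewrite s4 s4'.
- exact: e.
apply: (aut_of_piso us us' _ finj pf) => [|r ur rs r3]; first by rewrite s4.
have [x xs xr] : exists2 x, x \in s & x \notin r.
  apply/hasP; rewrite has_predC; apply/negP=> /allP h.
  by have := uniq_leq_size us h; rewrite s4 r3.
have sub : {subset r <= rem x s}.
  by move=> y yr; rewrite mem_rem_uniq // inE rs // andbT; apply: contraNneq xr => <-.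
have [|_ mr] := uniq_min_size ur sub; first by rewrite size_rem // s4 r3.
rewrite (eq_Fs mr) fc //; apply: eq_Fs => y; rewrite mem_rem_uniq // inE -(perm_mem pf).
apply/andP/mapP => [[yx /mapP[z zs yz]]|[z zr ->]].
  exists z => //; rewrite mr mem_rem_uniq // inE zs andbT.
  by apply: contraNneq yx => zx; rewrite yz zx.
have zs := rs z zr; split; last exact: map_f.
by apply: contraNneq xr => /finj <-.
Qed.

(** The tournament is the orbit of a pair [(a, b)] that cannot be sent to some [(c, d)]. By
    2-set-homogeneity it can be sent to [(d, c)]; an automorphism exchanging [a] and [b] beforehand
    would then send it to [(c, d)] after all, so the orbit is asymmetric. *)
Lemma invariant_tournament : ~ two_transitive F -> exists T : rel V,
  [/\ forall x y, x != y -> T x y = ~~ T y x, irreflexive T,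
      forall g x y, aut g -> T (g x) (g y) = T x y &
      forall x y x' y', T x y -> T x' y' -> exists g, [/\ aut g, g x = x' & g y = y']].
Proof.
move=> n2; have [a [b [c [d [ab cd nog]]]]] : exists a b c d,
    [/\ a <> b, c <> d & forall g, aut g -> g a = c -> g b = d -> False].
  apply: NNPP => n; apply: n2 => a b c d ab cd; apply: NNPP => ng; apply: n.
  by exists a, b, c, d; split=> // g ga gac gbd; apply: ng; exists g.
have two x y x' y' : x <> y -> x' <> y' ->
    exists2 g, aut g & (g x = x' /\ g y = y') \/ (g x = y' /\ g y = x').
  move=> /eqP xy /eqP xy'.
  have [|||| g ga pg] := @seq_hom2 [:: x; y] [:: x'; y']; rewrite //= ?inE ?xy ?xy' //.
  exists g => //; have gxy : g x != g y by rewrite (inj_eq (aut_inj ga)).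
  have := perm_mem pg (g x); have := perm_mem pg (g y).
  rewrite !inE !eqxx ?orbT /= => /esym/orP[]/eqP ey /esym/orP[]/eqP ex; auto.
    by rewrite ex ey eqxx in gxy.
  by rewrite ex ey eqxx in gxy.
pose P x y := exists g, [/\ aut g, g a = x & g b = y].
have noswap g : aut g -> g a = b -> g b = a -> False.
  move=> ga gab gba; have [h ha [[hac hbd]|[had hbc]]] := two _ _ _ _ ab cd; first exact: nog ha hac hbd.
  by apply: (nog _ (aut_comp ga ha)); rewrite /= ?gab ?gba.
have Ptot x y : x <> y -> P x y \/ P y x.
  by move=> /(two _ _ _ _ ab) [g ga [[]|[]]] *; [left | right]; exists g.
have Pasym x y : P x y -> P y x -> False.
  move=> [g [ga gax gby]] [h [ha hay hbx]]; have [k ka [hk kh]] := aut_inv ha.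
  apply: (noswap _ (aut_comp ga ka)) => /=; first by rewrite gax -hbx hk.
  by rewrite gby -hay hk.
exists (fun x y => asbool (P x y)); split.
- move=> x y /eqP xy; case: (asboolP (P y x)) => h /=; last by apply/asboolP; case: (Ptot _ _ xy).
  by apply/negbTE/asboolP => /Pasym; apply.
- by move=> x; apply/negbTE/asboolP => h0; exact: (Pasym _ _ h0 h0).
- move=> g x y ga; apply/asboolP/asboolP => -[h [ha hx hy]]; last first.
    by exists (g \o h); split; rewrite /= ?hx ?hy //; exact: aut_comp.
  have [k ka [kg gk]] := aut_inv ga.
  by exists (k \o h); split; rewrite /= ?hx ?hy ?kg //; exact: aut_comp.
move=> x y x' y' /asboolP[g [ga gx gy]] /asboolP[h [ha hx hy]].
have [k ka [kg gk]] := aut_inv ga.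
by exists (h \o k); split; [exact: aut_comp | rewrite /= -gx kg | rewrite /= -gy kg].
Qed.

End Aut.

(** * Tournaments and local orders *)

Definition tournament (V : eqType) (T : rel V) : Prop :=
  irreflexive T /\ forall x y, x != y -> T x y = ~~ T y x.

Definition cyc3 (V : Type) (T : rel V) x y z := [&& T x y, T y z & T z x].

Section Tournament.
Variables (V : eqType) (T : rel V).
Hypothesis tT : tournament T.

Lemma T_asym x y : T x y -> T y x = false.
Proof.
case: tT => irr tot; have [->|xy] := eqVneq x y; first by rewrite irr.
by rewrite (tot x y xy) => /negbTE.
Qed.

Lemma T_neq x y : T x y -> x != y.
Proof. by case: tT => irr _; apply: contraTneq => ->; rewrite irr. Qed.

Lemma T_total x y : x != y -> T x y = false -> T y x.
Proof. by case: tT => _ tot xy; rewrite tot // => /negbFE. Qed.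

(** The head of such a list is the one point dominating all others, hence determined by the
    underlying set. This makes automorphisms rigid on ordered sets. *)
Lemma pairwise_perm_eq (s s' : seq V) :
  pairwise T s -> pairwise T s' -> perm_eq s s' -> s = s'.
Proof.
elim: s s' => [|x s IH] s'; first by move=> _ _; rewrite perm_sym => /perm_nilP.
case: s' => [|y s'] /=; first by move=> _ _ /perm_nilP.
move=> /andP[/allP xs ps] /andP[/allP ys ps'] p.
have xy : x = y.
  apply/eqP; apply: contraT => nxy.
  have yx : y \in s by have := perm_mem p y; rewrite !inE eqxx eq_sym (negbTE nxy) /= => ->.
  have xy : x \in s' by have := perm_mem p x; rewrite !inE eqxx (negbTE nxy) /= => <-.
  by have := T_asym (xs y yx); rewrite (ys x xy).
by move: p; rewrite xy perm_cons => /(IH _ ps ps') ->.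
Qed.

End Tournament.

Lemma tournament_rev (V : eqType) (T : rel V) :
  tournament T -> tournament (fun x y => T y x).
Proof. by case=> irr tot; split=> // x y; rewrite eq_sym; apply: tot. Qed.

Definition preserves (V : Type) (T : rel V) (g : V -> V) := forall x y, T (g x) (g y) = T x y.

(* Suppose that in-neighbourhoods contain no 3-cycle, and let [Q] be the
   out-neighbourhood of [q].  If [r -> r'] in [Q] then every [x -> q] dominating
   [r'] dominates [r].  Along a 3-cycle of [Q] this gives equalities, hence by
   homogeneity each [x -> q] dominates all or nothing in [Q]; but as the
   arcs are all alike, both behaviours occur among the arcs [x -> q], [q -> r]. *)
Lemma no_dominating_cycle (V : eqType) (T : rel V) a x y z : tournament T ->
  (forall x y x' y', T x y -> T x' y' -> exists g, [/\ preserves T g, g x = x' & g y = y']) ->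
  (forall x y z x' y' z', pairwise T [:: x; y; z] -> pairwise T [:: x'; y'; z'] ->
     exists g, [/\ preserves T g, g x = x', g y = y' & g z = z']) ->
  (forall d x y z, T x d -> T y d -> T z d -> ~~ cyc3 T x y z) ->
  T a x -> T a y -> T a z -> ~~ cyc3 T x y z.
Proof.
move=> tT hom2 hom3 noL ax ay az; apply/and3P=> -[xy yz zx].
have mono q r r' u : T q r -> T q r' -> T r r' -> T u q -> T u r' -> T u r.
  move=> qr qr' rr' uq ur'; apply: contraTT (noL r' u q r ur' qr' rr') => nur.
  rewrite negbK /cyc3 uq qr /=; apply: (T_total tT); last exact: negbTE.
  by apply: contraTneq uq => ->; rewrite (T_asym tT qr).
have eq1 u : T u a -> T u x = T u y.
  move=> ua; apply/idP/idP; last exact: mono ax ay xy ua.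
  by move=> /(mono _ _ _ _ az ax zx ua); apply: mono ay az yz ua.
have eq2 q s s' u : T q s -> T q s' -> T u q -> T u s = T u s'.
  have main r r' v : T q r -> T q r' -> T r r' -> T v q -> T v r = T v r'.
    move=> qr qr' rr' vq; have [||g [gT gq gr gr']] := hom3 q r r' a x y.
    - by rewrite /= qr qr' rr'.
    - by rewrite /= ax ay xy.
    by rewrite -(gT v r) -(gT v r') gr gr'; apply: eq1; rewrite -gq gT.
  move=> qs qs' uq; have [->//|n] := eqVneq s s'.
  case ss': (T s s'); first exact: main.
  by apply/esym/main => //; apply: (T_total tT).
have [g [gT ga gx]] := hom2 _ _ _ _ ax zx.
have xgy : T x (g y) by rewrite -gx gT.
have zgy : T z (g y) by rewrite -ga gT.
by have := eq2 _ _ _ _ xgy xy zx; rewrite zgy (T_asym tT yz).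
Qed.

Definition local_order (V : eqType) (T : rel V) : Prop := forall d x y z,
  (T x d -> T y d -> T z d -> ~~ cyc3 T x y z) /\
  (T d x -> T d y -> T d z -> ~~ cyc3 T x y z).

Definition pair_dense (V : eqType) (T : rel V) : Prop := forall x y, x != y ->
  forall p q, exists z, [/\ z != x, z != y, T x z = p & T z y = q].

(* Picture a local order as points of a circle, with [x -> y] if [y] lies on
   the half circle following [x].  Identifying antipodes and cutting at [o]
   gives the linear order [cut_lt], coloured by the side of [o] the point was on. *)
Definition cut_lt (V : eqType) (T : rel V) (o x y : V) : bool :=
  [&& x != o, y != o & T x y (+) (T o x (+) T o y)].

Section CutOrder.
Variables (V : eqType) (T : rel V) (o : V).
Hypotheses (tT : tournament T) (loT : local_order T).
Local Notation lo := (cut_lt T o).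

Lemma cut_irr x : ~ lo x x.
Proof. by case: tT => irr _; rewrite /cut_lt irr addbb !andbF. Qed.

Lemma cut_asym x y : x != y -> x != o -> y != o -> lo x y = ~~ lo y x.
Proof.
move=> xy xo yo; case: tT => _ tot; rewrite /cut_lt xo yo /= (tot x y xy).
by rewrite [T o y (+) _]addbC addNb.
Qed.

Lemma cut_trans y x z : lo x y -> lo y z -> lo x z.
Proof.
move=> /and3P[xo yo xy] /and3P[_ zo yz]; rewrite /cut_lt xo zo /=.
case: tT => irr tot.
have nxy : x != y by apply: contraTneq xy => ->; rewrite irr addbb.
have nyz : y != z by apply: contraTneq yz => ->; rewrite irr addbb.
have [e|nxz] := eqVneq x z.
  by move: yz; rewrite -e (tot y x) 1?eq_sym // addNb [T o y (+) _]addbC xy.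
(* Each of the four points serves as centre, with both orientations of the other three; the rest is
   a Boolean check. *)
move: (loT o x y z) (loT o x z y) (loT x o y z) (loT x o z y) (loT y o x z) (loT y o z x) (loT z o x y) (loT z o y x) xy yz.
rewrite /cyc3 (tot y x) 1?eq_sym // (tot z y) 1?eq_sym // (tot z x) 1?eq_sym //.
rewrite (tot x o) // (tot y o) // (tot z o) //.
case: (T x y); case: (T y z); case: (T x z); case: (T o x); case: (T o y); case: (T o z) => /=; intuition.
Qed.

Hypothesis denseT : pair_dense T.

Lemma cut_dense_color k (ex_o : exists x, x != o) : exists z, z != o /\ T o z = k.
Proof.
by have [x xo] := ex_o; have [|z [zo _ zk _]] := denseT (x := o) (y := x) _ k k; [rewrite eq_sym | exists z].
Qed.

Lemma cut_dense_above x k : x != o -> exists z, lo x z /\ T o z = k.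
Proof.
(* For a point [z] of colour [k], being above [x] in the cut order means [T z x = k (+) T o x]. *)
case: tT => irr tot xo; have [|z [zo zx oz zq]] := denseT (x := o) (y := x) _ k (k (+) T o x).
  by rewrite eq_sym.
exists z; split=> //; rewrite /cut_lt xo zo oz (tot x z) 1?eq_sym // zq.
by case: k {oz zq}; case: (T o x).
Qed.

Lemma cut_dense_below x k : x != o -> exists z, lo z x /\ T o z = k.
Proof.
case: tT => irr tot xo; have [|z [zo zx oz zq]] := denseT (x := o) (y := x) _ k (~~ (k (+) T o x)).
  by rewrite eq_sym.
exists z; split=> //; rewrite /cut_lt xo zo oz zq.
by case: k {oz zq}; case: (T o x).
Qed.

(** [pair_dense] controls the arcs to [x] and [y] but not the colour of [z]. The arcs are chosen so
    that colour [k] puts [z] between [x] and [y], while the other colour would put it above [y] and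
    below [x], against [lo x y]. *)
Lemma cut_dense_between x y k : lo x y -> exists z, [/\ lo x z, lo z y & T o z = k].
Proof.
case: tT => irr tot xy; have [xo yo _] := and3P xy.
have nxy : x != y by apply: contraTneq xy => ->; apply/negP/cut_irr.
have [z [zx zy xz zy']] := denseT nxy (~~ (T o x (+) k)) (~~ (T o y (+) k)).
have zo : z != o.
  apply/eqP=> e; move: xz zy'; rewrite e (tot x o) //.
  by case: (T o x); case: (T o y); case: k.
have zk : T o z = k.
  apply/eqP; apply: contraT => ozk.
  have yz : lo y z.
    rewrite /cut_lt yo zo (tot y z) 1?eq_sym // zy' /=.
    by move: ozk; case: (T o y); case: (T o z); case: (k).
  have zx' : lo z x.
    rewrite /cut_lt xo zo (tot z x) // xz /=.
    by move: ozk; case: (T o x); case: (T o z); case: (k).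
  by move: (cut_asym nxy xo yo); rewrite xy (cut_trans yz zx').
exists z; split=> //; rewrite /cut_lt ?xo ?yo zo zk ?xz ?zy' /=.
  by case: (T o x); case: (k).
by case: (T o y); case: (k).
Qed.
End CutOrder.

(** * Back and forth for local orders *)

Section LocalOrderIso.
Variables (A B : countType) (T : rel A) (T' : rel B) (o : A) (o' : B).
Hypotheses (tT : tournament T) (loT : local_order T).
Hypotheses (tT' : tournament T') (loT' : local_order T') (denseT' : pair_dense T').
Hypothesis ex_o' : exists x, x != o'.

Definition tour_piso (p : seq (A * B)) : Prop := (o, o') \in p /\
  forall u v, u \in p -> v \in p -> (u.1 = v.1 <-> u.2 = v.2) /\ T u.1 v.1 = T' u.2 v.2.

(** With [o] in the domain, [T] is recovered from the cut order and the colours. Both colours being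
    dense in the target, the argument is the one for a dense linear order with two dense colours. *)
Lemma tour_forth p : tour_piso p -> forall a, exists b, tour_piso ((a, b) :: p).
Proof.
move=> [op pP] a; have [irr tot] := tT; have [irr' tot'] := tT'.
have [/mapP[[a' b] ab /= ->]|ap] := boolP (a \in map fst p).
  exists b; split=> [|u v]; first by rewrite inE op orbT.
  rewrite !inE => /orP[/eqP->|up] /orP[/eqP->|vp]; exact: pP.
have na u : u \in p -> u.1 != a.
  by move=> up; apply: contraNneq ap => <-; apply: map_f.
have ao : a != o by rewrite eq_sym (na _ op).
have lo_eq u v : u \in p -> v \in p -> cut_lt T o u.1 v.1 = cut_lt T' o' u.2 v.2.
  move=> up vp; have [_ eo_u] := pP _ _ op up; have [_ eo_v] := pP _ _ op vp.
  have [_ e] := pP _ _ up vp; have [hu _] := pP _ _ up op; have [hv _] := pP _ _ vp op.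
  rewrite /cut_lt e -eo_u -eo_v /=.
  by congr [&& ~~ _, ~~ _ & _]; apply/eqP/eqP; [apply hu | apply hu | apply hv | apply hv].
have oE u : u \in p -> (u.2 == o') = (u.1 == o).
  by move=> up; have [h _] := pP _ _ up op; apply/eqP/eqP => /h.
suff [b [bo bc blo bup]] : exists b, [/\ b != o', T' o' b = T o a,
    forall u, u \in p -> cut_lt T o u.1 a -> cut_lt T' o' u.2 b &
    forall u, u \in p -> cut_lt T o a u.1 -> cut_lt T' o' b u.2].
  have neqb u : u \in p -> u.2 != b.
    move=> up; have [->|uo] := eqVneq u.2 o'; first by rewrite eq_sym.
    have uo1 : u.1 != o.
      by apply: contraNneq uo => e; have [[h _] _] := pP _ _ up op; rewrite (h e).
    apply/eqP=> e; case lua : (cut_lt T o u.1 a).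
      by have := blo u up lua; rewrite e => /(cut_irr tT').
    have := bup u up; rewrite (cut_asym tT (na u up) uo1 ao) in lua.
    by rewrite (negbFE lua) e => /(_ isT)/(cut_irr tT').
  have Tb u : u \in p -> T u.1 a = T' u.2 b.
    move=> up; have [uo|uo1] := eqVneq u.1 o.
      by have [[h _] _] := pP _ _ up op; rewrite uo (h uo).
    have uo' : u.2 != o' by rewrite oE.
    have [_ eo] := pP _ _ op up; rewrite /= in eo.
    have : cut_lt T o u.1 a = cut_lt T' o' u.2 b.
      apply/idP/idP; first exact: blo.
      rewrite (cut_asym tT (na u up) uo1 ao) (cut_asym tT' (neqb u up) uo' bo).
      by apply: contra => /(bup u up).
    rewrite /cut_lt uo1 ao uo' bo -eo bc /=.
    by case: (T u.1 a); case: (T' u.2 b); case: (T o u.1); case: (T o a).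
  exists b; split=> [|u v]; first by rewrite inE op orbT.
  rewrite !inE => /orP[/eqP->|up] /orP[/eqP->|vp] /=.
  - by rewrite irr irr'.
  - rewrite (tot a v.1) 1?eq_sym ?na // (tot' b v.2) 1?eq_sym ?neqb // Tb //; split=> //.
    by split=> e; [have := na v vp | have := neqb v vp]; rewrite e eqxx.
  - rewrite Tb //; split=> //.
    by split=> e; [have := na u up | have := neqb u up]; rewrite e eqxx.
  exact: pP.
have lo_max : (exists2 u, u \in p & cut_lt T o u.1 a) -> exists m, [/\ m \in p, cut_lt T o m.1 a &
    forall u, u \in p -> cut_lt T o u.1 a -> u = m \/ cut_lt T' o' u.2 m.2].
  move=> h; have [||m [mp ma mmax]] := exists_maximal (R := fun u v => cut_lt T o u.1 v.1) _ _ h.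
  - by move=> u; apply: cut_irr.
  - by move=> v u w; apply: cut_trans.
  exists m; split=> // u up ua; have [->|um] := eqVneq u m; [by left | right].
  rewrite -lo_eq //; have [uo _ _] := and3P ua; have [mo _ _] := and3P ma.
  rewrite (cut_asym tT _ uo mo); first by apply/negP; apply: mmax.
  apply: contraNneq um => e; have [[h1 _] _] := pP _ _ up mp.
  by case: u m e h1 {up ua mp ma mmax uo mo} => [u1 u2] [m1 m2] /= e h1; rewrite e (h1 e).
have up_min : (exists2 u, u \in p & cut_lt T o a u.1) -> exists m, [/\ m \in p, cut_lt T o a m.1 &
    forall u, u \in p -> cut_lt T o a u.1 -> u = m \/ cut_lt T' o' m.2 u.2].
  move=> h; have [||m [mp ma mmax]] := exists_maximal (R := fun u v => cut_lt T o v.1 u.1) _ _ h.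
  - by move=> u; apply: cut_irr.
  - by move=> v u w h1 h2; apply: (cut_trans tT loT h2 h1).
  exists m; split=> // u up ua; have [->|um] := eqVneq u m; [by left | right].
  rewrite -lo_eq //; have [_ uo _] := and3P ua; have [_ mo _] := and3P ma.
  rewrite (cut_asym tT _ mo uo); first by apply/negP; apply: mmax.
  apply: contraNneq um => e; have [[_ h1] _] := pP _ _ mp up.
  have [[h2 _] _] := pP _ _ mp up.
  by case: u m e h2 {up ua mp ma mmax uo mo h1} => [u1 u2] [m1 m2] /= e h1; rewrite e (h1 e).
have [exL|nL] := classic (exists2 u, u \in p & cut_lt T o u.1 a);
  have [exU|nU] := classic (exists2 u, u \in p & cut_lt T o a u.1).
- have [l [lp la lmax]] := lo_max exL; have [m [mp am mmin]] := up_min exU.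
  have lm : cut_lt T' o' l.2 m.2 by rewrite -lo_eq //; apply: (cut_trans tT loT la am).
  have [b [lb bm bc]] := cut_dense_between tT' loT' denseT' (T o a) lm.
  exists b; split=> //; first by case/and3P: lb.
    by move=> u up /(lmax u up)[->//|h]; exact: (cut_trans tT' loT' h lb).
  by move=> u up /(mmin u up)[->//|h]; exact: (cut_trans tT' loT' bm h).
- have [l [lp la lmax]] := lo_max exL.
  have lo' : l.2 != o' by rewrite oE //; case/and3P: la.
  have [b [lb bc]] := cut_dense_above tT' denseT' (T o a) lo'.
  exists b; split=> //; first by case/and3P: lb.
    by move=> u up /(lmax u up)[->//|h]; exact: (cut_trans tT' loT' h lb).
  by move=> u up ua; case: nU; exists u.
- have [m [mp am mmin]] := up_min exU.
  have mo' : m.2 != o' by rewrite oE //; case/and3P: am.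
  have [b [bm bc]] := cut_dense_below tT' denseT' (T o a) mo'.
  exists b; split=> //; first by case/and3P: bm.
    by move=> u up ua; case: nL; exists u.
  by move=> u up /(mmin u up)[->//|h]; exact: (cut_trans tT' loT' bm h).
have [b [bo bc]] := cut_dense_color denseT' (T o a) ex_o'.
exists b; split=> // u up ua; [case: nL | case: nU]; by exists u.
Qed.
End LocalOrderIso.

Lemma local_order_rev (V : eqType) (T : rel V) : local_order T -> local_order (fun x y => T y x).
Proof.
move=> lo d x y z; have [h1 h2] := lo d x z y; rewrite /cyc3.
by split=> xd yd zd; [move: (h2 xd zd yd) | move: (h1 xd zd yd)]; rewrite /cyc3; case: (T x z); case: (T z y); case: (T y x).
Qed.

Lemma pair_dense_rev (V : eqType) (T : rel V) :
  pair_dense T -> pair_dense (fun x y => T y x).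
Proof.
move=> dT x y xy p q; have yx : y != x by rewrite eq_sym.
by have [z [zy zx yz zx']] := dT y x yx q p; exists z.
Qed.

Lemma tour_piso_swap (A B : countType) (T : rel A) (T' : rel B) o o' (p : seq (A * B)) :
  tour_piso T T' o o' p -> tour_piso T' T o' o [seq (u.2, u.1) | u <- p].
Proof.
move=> [op pP]; split; first by apply/mapP; exists (o, o').
move=> u v /mapP[u' up ->] /mapP[v' vp ->] /=; have [e ->] := pP _ _ up vp.
by split=> //; apply: iff_sym.
Qed.

(** Local orders and their density are invariant under reversal, so [T] and its reverse are
    isomorphic by the same back and forth. *)
Lemma local_order_antiaut (V : countType) (T : rel V) : tournament T -> local_order T ->
  pair_dense T -> (exists x y : V, x != y) ->
  exists phi : V -> V, bijective phi /\ forall x y, T (phi x) (phi y) = T y x.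
Proof.
move=> tT loT dT [o [o2 oo2]].
pose T' x y := T y x.
have tT' : tournament T' := tournament_rev tT.
have loT' : local_order T' := local_order_rev loT.
have dT' : pair_dense T' := pair_dense_rev dT.
have ex_o : exists x, x != o by exists o2; rewrite eq_sym.
have p0P : tour_piso T T' o o [:: (o, o)].
  split=> [|u v]; first by rewrite mem_head.
  by rewrite !inE => /eqP-> /eqP->.
have [|||phi [bij _ fin]] := @back_and_forth V V (tour_piso T T' o o) _ _ _ _ p0P.
- by move=> p pP a; apply: (tour_forth tT loT tT' loT' dT' ex_o).
- move=> p /tour_piso_swap pP b.
  have [a /tour_piso_swap h] := tour_forth tT' loT' tT loT dT ex_o pP b.
  by exists a; move: h; rewrite /= -map_comp (eq_map (g := id)) ?map_id // => -[].
- by move=> p a b a' b' [_ pP] i i'; have [] := pP _ _ i i'.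
exists phi; split=> // x y.
have [p [_ pP] h] := fin [:: x; y].
by have [||_ /= ->] := pP (y, phi y) (x, phi x); rewrite // ?h ?inE ?eqxx ?orbT.
Qed.

Lemma ty4E (V : countType) (F : {fset V} -> Prop) a b c d : uniq [:: a; b; c; d] ->
  ty F [:: a; b; c; d] = [:: Fs F [:: b; c; d]; Fs F [:: a; c; d]; Fs F [:: a; b; d]; Fs F [:: a; b; c]].
Proof.
rewrite /= !inE !negb_or => /and4P[/and3P[ab ac ad] /andP[bc bd] cd _].
by rewrite /ty /= !eqxx (negbTE ab) (negbTE ac) (negbTE ad) (negbTE bc) (negbTE bd) (negbTE cd).
Qed.

(** * Excluding 3-cycles from the invariant tournament *)

Section Invariant.
Variables (V : countType) (F : {fset V} -> Prop) (T : rel V).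
Hypotheses (infV : countably_infinite V) (homF : le_set_hom F 4).
Hypotheses (tT : tournament T) (autT : forall g x y, is_aut F g -> T (g x) (g y) = T x y).
Hypothesis hom2 : forall x y x' y', T x y -> T x' y' -> exists g, [/\ is_aut F g, g x = x' & g y = y'].
Local Notation Fs := (Fs F).

Lemma pairwise_T_uniq s : pairwise T s -> uniq s.
Proof. by case: tT => irr _; apply: pairwise_uniq. Qed.

Lemma pairwise_aut g s s' : is_aut F g -> pairwise T s -> pairwise T s' ->
  perm_eq (map g s) s' -> map g s = s'.
Proof.
move=> ga ps ps'; apply: (pairwise_perm_eq tT) => //.
rewrite pairwise_map; apply: sub_pairwise ps => x y; by rewrite /relpre /= autT.
Qed.

Section Cyclic.
Variable k : bool.
Hypothesis Fcyc : forall x y z, uniq [:: x; y; z] -> Fs [:: x; y; z] = k (+) (cyc3 T x y z || cyc3 T x z y).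
Hypothesis ex_cyc : exists x y z, cyc3 T x y z.
Hypothesis ex_trans : exists x y z, pairwise T [:: x; y; z].

Lemma Fs_trans x y z : pairwise T [:: x; y; z] -> Fs [:: x; y; z] = k.
Proof.
move=> p; rewrite Fcyc ?pairwise_T_uniq //; move: p; rewrite /= !andbT => /andP[/andP[xy xz] yz].
by rewrite /cyc3 (T_asym tT xz) (T_asym tT xy) !andbF addbF.
Qed.

Lemma cyc_uniq x y z : cyc3 T x y z -> uniq [:: x; y; z].
Proof.
move=> /and3P[xy yz zx].
by rewrite /= !inE negb_or (T_neq tT xy) (T_neq tT yz) eq_sym (T_neq tT zx).
Qed.

Lemma Fs_cyc x y z : cyc3 T x y z -> Fs [:: x; y; z] = ~~ k.
Proof. by move=> c; rewrite Fcyc ?cyc_uniq // c /= addbT. Qed.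

Lemma trans_hom x y z x' y' z' : pairwise T [:: x; y; z] -> pairwise T [:: x'; y'; z'] ->
  exists g, [/\ is_aut F g, g x = x', g y = y' & g z = z'].
Proof.
move=> p p'; have [||||| g ga gp] := seq_hom3 homF (s := [:: x; y; z]) (s' := [:: x'; y'; z']);
  rewrite ?pairwise_T_uniq ?Fs_trans //.
by have [? ? ?] := pairwise_aut ga p p' gp; exists g.
Qed.

(** All arcs being alike, the patterns of a third point can be read off from any arc: the three arcs
    of a transitive triple show three of them, a 3-cycle shows the fourth. *)
Lemma trans_pair_dense : pair_dense T.
Proof.
have [irr tot] := tT; have [a [b [c /and3P[ab bc ca]]]] := ex_cyc.
have [u [v [w]]] := ex_trans; rewrite /= !andbT => /andP[/andP[uv uw] vw].
have move x y a1 a2 a3 : T x y -> T a1 a2 -> a3 != a1 -> a3 != a2 ->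
    exists z, [/\ z != x, z != y, T x z = T a1 a3 & T z y = T a3 a2].
  move=> xy a12 n1 n2; have [g [ga gx gy]] := hom2 a12 xy; exists (g a3).
  by rewrite -gx -gy !autT // !(inj_eq (aut_inj ga)).
have nba : b != a by rewrite eq_sym (T_neq tT ab).
have nbc := T_neq tT bc; have ncb : c != b by rewrite eq_sym.
have nca := T_neq tT ca; have nac : a != c by rewrite eq_sym.
have nuv := T_neq tT uv; have nvu : v != u by rewrite eq_sym.
have nuw := T_neq tT uw; have nwu : w != u by rewrite eq_sym.
have nvw := T_neq tT vw; have nwv : w != v by rewrite eq_sym.
have main x y p q : T x y -> exists z, [/\ z != x, z != y, T x z = p & T z y = q].
  move=> xy; case: p; case: q.
  - by have := move x y u w v xy uw nvu nvw; rewrite uv vw.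
  - by have := move x y u v w xy uv nwu nwv; rewrite uw (T_asym tT vw).
  - by have := move x y v w u xy vw nuv nuw; rewrite uw (T_asym tT uv).
  by have := move x y a b c xy ab nca ncb; rewrite (T_asym tT ca) (T_asym tT bc).
move=> x y nxy p q; case xy: (T x y); first exact: main.
have [z [zy zx yz zx']] := main y x (~~ q) (~~ p) (T_total tT nxy xy).
exists z; split=> //; first by rewrite tot 1?eq_sym // zx' negbK.
by rewrite tot // yz negbK.
Qed.

(** Both 4-sets have three triples of colour [k] and one of the other, so an automorphism carries
    the first to the second. It preserves [T], but in the second set every point is dominated by
    another one. *)
Lemma no_winner_and_loser a x y z b x' y' z' :
  T a x -> T a y -> T a z -> cyc3 T x y z ->
  T x' b -> T y' b -> T z' b -> cyc3 T x' y' z' -> False.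
Proof.
move=> ax ay az c xb yb zb c'; have [xy yz zx] := and3P c; have [xy' yz' zx'] := and3P c'.
have nax := T_neq tT ax; have nay := T_neq tT ay; have naz := T_neq tT az.
have u : uniq [:: a; x; y; z] by move: (cyc_uniq c); rewrite /= !inE !negb_or nax nay naz.
have u' : uniq [:: b; x'; y'; z'].
  move: (cyc_uniq c'); rewrite /= !inE !negb_or ![b == _]eq_sym.
  by rewrite (T_neq tT xb) (T_neq tT yb) (T_neq tT zb).
have out2 p q r : T p q -> T p r -> q != r -> Fs [:: p; q; r] = k.
  move=> pq pr qr; rewrite Fcyc; last by rewrite /= !inE negb_or (T_neq tT pq) (T_neq tT pr) qr.
  by rewrite /cyc3 (T_asym tT pq) (T_asym tT pr) !andbF addbF.
have in2 p q r : T q p -> T r p -> q != r -> Fs [:: p; q; r] = k.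
  move=> qp rp qr; rewrite Fcyc; first by rewrite /cyc3 (T_asym tT qp) (T_asym tT rp) addbF.
  by rewrite /= !inE negb_or ![p == _]eq_sym (T_neq tT qp) (T_neq tT rp) qr.
have xz : x != z by rewrite eq_sym (T_neq tT zx).
have xz' : x' != z' by rewrite eq_sym (T_neq tT zx').
have cnt : count id (ty F [:: a; x; y; z]) = count id (ty F [:: b; x'; y'; z']).
  rewrite !ty4E // (Fs_cyc c) (Fs_cyc c').
  rewrite (out2 _ _ _ ay az (T_neq tT yz)) (out2 _ _ _ ax az xz) (out2 _ _ _ ax ay (T_neq tT xy)).
  by rewrite (in2 _ _ _ yb zb (T_neq tT yz')) (in2 _ _ _ xb zb xz') (in2 _ _ _ xb yb (T_neq tT xy')).
have [g ga gp] := seq_hom4 homF u u' erefl erefl cnt.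
have dom v : v \in [:: x; y; z] -> T (g a) (g v).
  by rewrite autT // !inE => /or3P[]/eqP->.
have mem w : w \in [:: b; x'; y'; z'] -> w = g a \/ exists2 v, v \in [:: x; y; z] & w = g v.
  rewrite -(perm_mem gp) => /mapP[v]; rewrite inE => /orP[/eqP->|vs ->]; [by left | by right; exists v].
have abs w v : w = g a -> v \in [:: b; x'; y'; z'] -> T v w -> False.
  move=> -> /mem[->|[t ts ->]]; first by case: tT => ->.
  by rewrite (T_asym tT (dom t ts)).
have : g a \in [:: b; x'; y'; z'] by rewrite -(perm_mem gp) mem_head.
rewrite !inE => /or4P[]/eqP/esym e; apply: (abs _ _ e).
- 2: exact: xb. by rewrite !inE eqxx ?orbT.
- 2: exact: zx'. by rewrite !inE eqxx ?orbT.
- 2: exact: xy'. by rewrite !inE eqxx ?orbT.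
- 2: exact: yz'. by rewrite !inE eqxx ?orbT.
Qed.

(** The two forbidden configurations cannot both occur, and by [no_dominating_cycle], for [T] or its
    reverse, the absence of one excludes the other. *)
Lemma cyclic_local_order : local_order T.
Proof.
have noL_noW : (forall d x y z, T x d -> T y d -> T z d -> ~~ cyc3 T x y z) \/
    (forall d x y z, T d x -> T d y -> T d z -> ~~ cyc3 T x y z).
  apply: NNPP => /not_or_and[nL nW]; apply: nL => b x' y' z' xb yb zb.
  apply/negP=> c'; apply: nW => a x y z ax ay az; apply/negP=> c.
  exact: no_winner_and_loser ax ay az c xb yb zb c'.
have pres g : is_aut F g -> preserves T g by move=> ga x y; apply: autT.
have noLW : (forall d x y z, T x d -> T y d -> T z d -> ~~ cyc3 T x y z) ->
    forall d x y z, T d x -> T d y -> T d z -> ~~ cyc3 T x y z.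
  move=> noL d x y z; apply: no_dominating_cycle => //.
    by move=> ? ? ? ? h h'; have [g [ga ? ?]] := hom2 h h'; exists g; split=> //; apply: pres.
  by move=> ? ? ? ? ? ? h h'; have [g [ga ? ? ?]] := trans_hom h h'; exists g; split=> //; apply: pres.
have noWL : (forall d x y z, T d x -> T d y -> T d z -> ~~ cyc3 T x y z) ->
    forall d x y z, T x d -> T y d -> T z d -> ~~ cyc3 T x y z.
  have crev u v w : cyc3 (fun x y => T y x) u v w = cyc3 T u w v.
    by rewrite /cyc3; case: (T v u); case: (T w v); case: (T u w).
  move=> noW d x y z xd yd zd; rewrite -crev.
  apply: (@no_dominating_cycle V (fun x y => T y x) d) => //; first exact: tournament_rev.
  - move=> a b a' b' h h'; have [g [ga ? ?]] := hom2 h h'; exists g; split=> // u v; exact: pres.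
  - move=> a b c a' b' c' h h'; have [||g [ga ? ? ?]] := @trans_hom c b a c' b' a'.
    + by move: h; rewrite /= !andbT => /andP[/andP[-> ->] ->].
    + by move: h'; rewrite /= !andbT => /andP[/andP[-> ->] ->].
    by exists g; split=> // u v; exact: pres.
  by move=> d' u v w du dv dw; rewrite crev; apply: (noW d').
move=> d x y z; case: noL_noW => h.
  by split; [exact: h | exact: (noLW h)].
by split; [exact: (noWL h) | exact: h].
Qed.

Lemma cyclic_absurd : False.
Proof.
have [a [b [c cabc]]] := ex_cyc; have [ab _ _] := and3P cabc.
have [phi [bij phiT]] : exists phi : V -> V, bijective phi /\ forall x y, T (phi x) (phi y) = T y x.
  apply: local_order_antiaut => //; [exact: cyclic_local_order | exact: trans_pair_dense |].
  by exists a, b; apply: T_neq ab.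
have pa : is_aut F phi.
  (* Reversing all arcs turns 3-cycles into 3-cycles, so the colour of a triple is unchanged. *)
  split=> // S /cardfs3P[x [y [z [-> /eqP xy /eqP yz /eqP xz]]]].
  have e3 u v w : [fset u; v; w] = [fset i in [:: u; v; w]].
    by apply/fsetP=> i; rewrite !inE orbF orbA.
  have inj := bij_inj bij.
  have : Fs [:: x; y; z] = Fs [:: phi x; phi y; phi z].
    rewrite !Fcyc /cyc3 ?phiT //=; last by rewrite !inE !negb_or xy xz yz.
      by congr (k (+) _); case: (T x y); case: (T y x); case: (T y z); case: (T z y); case: (T x z); case: (T z x).
    by rewrite !inE !negb_or !(inj_eq inj) xy xz yz.
  rewrite imfset3 !e3 => e.
  by split=> /asboolP h; apply/asboolP; [rewrite -[asbool _]e | rewrite [asbool _]e].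
by have := autT a b pa; rewrite phiT ab (T_asym tT ab).
Qed.
End Cyclic.

(** Of three other points, two lie on the same side of a given point and form a transitive triple
    with it. The proof runs through the tournaments on four points. *)
Lemma not_all_cyclic : exists u v w, pairwise T [:: u; v; w].
Proof.
have [irr tot] := tT.
have [a _] := infV [::]; have [b nb] := infV [:: a]; have [c nc] := infV [:: a; b].
have [d nd] := infV [:: a; b; c]; move: nb nc nd; rewrite !inE !negb_or.
move=> ba /andP[ca cb] /and3P[da db dc].
suff [u [v [w [uv uw vw]]]] : exists u v w, [/\ T u v, T u w & T v w].
  by exists u, v, w; rewrite /= uv uw vw.
case ab: (T a b); case ac: (T a c); case ad: (T a d);
case bc: (T b c); case bd: (T b d); case cd: (T c d);
move: (tot b a ba) (tot c a ca) (tot c b cb) (tot d a da) (tot d b db) (tot d c dc);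
rewrite ab ac ad bc bd cd /= => ba' ca' cb' da' db' dc';
first [by exists a, b, c | by exists a, c, b | by exists b, a, c | by exists b, c, a | by exists c, a, b | by exists c, b, a | by exists a, b, d | by exists a, d, b | by exists b, a, d | by exists b, d, a | by exists d, a, b | by exists d, b, a | by exists a, c, d | by exists a, d, c | by exists c, a, d | by exists c, d, a | by exists d, a, c | by exists d, c, a].
Qed.

(** Triples of one colour are exchanged by automorphisms, so they are all cyclic or all transitive.
    If both kinds exist, the colour therefore decides cyclicity, which [cyclic_absurd] refutes. *)
Lemma T_trans x y z : T x y -> T y z -> T x z.
Proof.
move=> xy yz; apply: contraT => nxz; exfalso.
have nxz' : x != z by apply: contraTneq yz => <-; rewrite (T_asym tT xy).
have cxyz : cyc3 T x y z by rewrite /cyc3 xy yz (T_total tT nxz' (negbTE nxz)).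
have isc_perm a b c u v w : perm_eq [:: a; b; c] [:: u; v; w] -> cyc3 T a b c ->
    cyc3 T u v w || cyc3 T u w v.
  move=> p /and3P[ab bc ca].
  have [irr _] := tT; have mem i : i \in [:: a; b; c] -> [|| i == u, i == v | i == w].
    by rewrite (perm_mem p) !inE.
  move: (mem a) (mem b) (mem c); rewrite !inE !eqxx !orbT => /(_ isT) ma /(_ isT) mb /(_ isT) mc.
  by case/or3P: ma ab ca => /eqP->; case/or3P: mb bc => /eqP->; case/or3P: mc => /eqP->;
    rewrite /cyc3 ?irr // => -> -> ->; rewrite ?orbT.
have isc_hom a b c u v w : uniq [:: a; b; c] -> uniq [:: u; v; w] -> Fs [:: a; b; c] = Fs [:: u; v; w] ->
    cyc3 T a b c || cyc3 T a c b -> cyc3 T u v w || cyc3 T u w v.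
  move=> u1 u2 e; have [g ga gp] := seq_hom3 homF u1 u2 erefl erefl e.
  have inv i j l : cyc3 T i j l -> cyc3 T (g i) (g j) (g l) by rewrite /cyc3 !autT.
  case/orP=> /inv; first exact: isc_perm gp.
  apply: isc_perm; apply: perm_trans gp.
  by rewrite /= perm_cons -[[:: g c; g b]]/([:: g c] ++ [:: g b]) perm_catC.
have uxyz := cyc_uniq cxyz.
have [p [q [r pqr]]] := not_all_cyclic.
have upqr := pairwise_T_uniq pqr.
have npqr : ~~ (cyc3 T p q r || cyc3 T p r q).
  move: pqr; rewrite /= !andbT => /andP[/andP[pq pr] qr].
  by rewrite /cyc3 (T_asym tT pq) (T_asym tT pr) !andbF.
(* The parameter is the colour of the transitive triples, opposite to that of the 3-cycle at
   hand. *)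
apply: (@cyclic_absurd (~~ Fs [:: x; y; z])); last by exists p, q, r.
  move=> u v w uvw; case: (boolP (cyc3 T u v w || cyc3 T u w v)) => isc.
    rewrite addbT negbK; apply/eqP; apply: contraT => ne.
    case/negP: npqr; case: (eqVneq (Fs [:: p; q; r]) (Fs [:: u; v; w])) => e.
      by apply: isc_hom isc => //.
    apply: (isc_hom x y z); rewrite ?cxyz //.
    by move: ne e; case: (Fs [:: x; y; z]); case: (Fs [:: u; v; w]); case: (Fs [:: p; q; r]).
  rewrite addbF; apply/eqP; apply: contraT => e.
  case/negP: isc; apply: (isc_hom x y z); rewrite ?cxyz //.
  by move: e; case: (Fs [:: x; y; z]); case: (Fs [:: u; v; w]).
by exists x, y, z.
Qed.

End Invariant.

(** * Types of 4-point subsets *)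

Definition omit (A : Type) (i : nat) (s : seq A) : seq A := take i s ++ drop i.+1 s.

Fixpoint bool_seqs (n : nat) : seq (seq bool) :=
  if n is m.+1 then [seq b :: s | b <- [:: false; true], s <- bool_seqs m] else [:: [::]].

(* By 4-set-homogeneity, at most one type with a given number of edges occurs. *)
Definition weight_choices (w : nat) : seq (seq (seq bool)) :=
  [::] :: [seq [:: t] | t <- bool_seqs 4 & count id t == w].

(** For the weights 0 to 4 this lists 2 · 5 · 7 · 5 · 2 = 700 candidates. *)
Definition type_sets (ws : seq nat) : seq (seq (seq bool)) :=
  foldr (fun w acc => [seq p ++ TT | p <- weight_choices w, TT <- acc]) [:: [::]] ws.

(* [fs] lists the first faces [f_0, .., f_(m-1)] of a 5-point set and [f] is the
   candidate for [f_m]: the faces agree on common triples when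
   [f_m i = f_i (m - 1)] for [i < m]. *)
Definition face_compatible (fs : seq (seq bool)) (f : seq bool) : bool :=
  all (fun i => nth false f i == nth false (nth [::] fs i) (size fs).-1) (iota 0 (size fs)).

Definition fillings (cands : seq (seq (seq bool))) : seq (seq (seq bool)) :=
  foldl (fun acc c => [seq rcons fs f | fs <- acc, f <- [seq f <- c | face_compatible fs f]]) [:: [::]] cands.

(* Can points be added to a triple at gaps [i] and [j], creating the types
   [t] and [u]?  The point added for [u] gets index [k] among the 5 points,
   hence the other one gets index [bump k i]. *)
Definition amalgamable (TT : seq (seq bool)) (t : seq bool) (i : nat) (u : seq bool) (j : nat) : bool :=
  ((i == j) && (t == u)) ||
  has (fun k => let l := bump k i in (bump l j == k) &&
    (fillings [seq if m == k then [:: t] else if m == l then [:: u] else TT | m <- iota 0 5] != [::]))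
    (iota 0 5).

(** The first condition excludes the set of the two constant types, which satisfies the other
    two. *)
Definition amalgamation_class (TT : seq (seq bool)) : bool :=
  [&& has (fun t => has id t && ~~ all id t) TT,
      all (fun i => all (fun v => has (fun t => nth false t i == v) TT) [:: false; true]) (iota 0 4) &
      all (fun t => all (fun u => all (fun i => all (fun j =>
        (nth false t i == nth false u j) ==> amalgamable TT t i u j) (iota 0 4)) (iota 0 4)) TT) TT].

(* These are the plane binary trees with leaves [a < b < c < d], namely
   ((ab)c)d, (a(bc))d, (ab)(cd), a((bc)d) and a(b(cd)); the entries of a type are
   the colours of bcd, acd, abd and abc. *)
Definition M3_types : seq (seq bool) :=
  [:: [:: false; false; false; false]; [:: false; false; false; true];
      [:: true; true; false; false]; [:: false; true; true; true]; [:: true; true; true; true]].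

(** Candidates list their types by increasing number of edges, and so do [M3_types] and its mirror
    image; hence equality of lists is the right test. *)
Lemma amalgamation_classes : all (fun TT => amalgamation_class TT ==>
  (TT \in [:: M3_types; [seq rev t | t <- M3_types]])) (type_sets (iota 0 5)).
Proof. by lazy. Qed.

(** [bump k] undoes the renumbering caused by the deletion of position [k]; faces of faces are
    compared through it. *)
Lemma nth_omit (A : Type) (x0 : A) (s : seq A) k i : k < size s -> nth x0 (omit k s) i = nth x0 s (bump k i).
Proof.
move=> ks; rewrite /omit nth_cat size_take ks /bump.
case: ltnP => ik; first by rewrite nth_take.
by rewrite nth_drop addSn subnKC.
Qed.

Lemma size_omit (A : Type) (s : seq A) k : k < size s -> size (omit k s) = (size s).-1.
Proof. by move=> ks; rewrite size_cat size_take ks size_drop; case: (size s) ks => // n; rewrite ltnS subSS => /subnKC. Qed.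

Lemma omit_subseq (A : eqType) (s : seq A) k : subseq (omit k s) s.
Proof.
rewrite -{2}(cat_take_drop k s); apply: cat_subseq => //.
by rewrite -add1n -drop_drop; apply: drop_subseq.
Qed.

Lemma pairwise_omit (A : eqType) (T : rel A) (s : seq A) k : pairwise T s -> pairwise T (omit k s).
Proof. exact/subseq_pairwise/omit_subseq. Qed.

Lemma perm_omit (A : eqType) (x0 : A) (s : seq A) k :
  k < size s -> perm_eq s (nth x0 s k :: omit k s).
Proof.
move=> ks; rewrite -{1}(cat_take_drop k s) (drop_nth x0 ks) /omit.
by rewrite perm_catC /= perm_cons perm_catC.
Qed.

(** Completeness of the search: the faces of an actual 5-point set appear among the fillings, so an
    empty search refutes amalgamation. *)
Lemma fillings_mkseq (f : nat -> seq bool) (cands : seq (seq (seq bool))) :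
  (forall m, m < size cands -> f m \in nth [::] cands m) ->
  (forall i m, i < m < size cands -> nth false (f m) i = nth false (f i) m.-1) ->
  mkseq f (size cands) \in fillings cands.
Proof.
elim/last_ind: cands => [|cands c IH] // fc comp.
rewrite /fillings -cats1 foldl_cat /= cats1 size_rcons -/(fillings cands).
have fm : f (size cands) \in c by have := fc (size cands); rewrite size_rcons nth_rcons ltnn eqxx; apply.
rewrite mkseqS; apply/allpairsPdep.
exists (mkseq f (size cands)), (f (size cands)); split=> //.
  apply: IH => [m ms|i m /andP[im ms]].
    by have := fc m; rewrite size_rcons nth_rcons ms; apply; apply: ltnW.
  by apply: comp; rewrite im size_rcons ltnW.
rewrite mem_filter fm andbT /face_compatible size_mkseq; apply/allP=> i; rewrite mem_iota add0n => /= im.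
by rewrite nth_mkseq // comp ?eqxx // im size_rcons /=.
Qed.

Lemma pairwise_insert (V : eqType) (T : rel V) (s : seq V) a : tournament T ->
  (forall x y z, T x y -> T y z -> T x z) -> pairwise T s -> a \notin s ->
  exists k, [/\ k <= size s & pairwise T (take k s ++ a :: drop k s)].
Proof.
move=> tT trT; elim: s => [|x s IH] /=; first by exists 0.
move=> /andP[xs ps]; rewrite inE negb_or => /andP[ax /(IH ps)[k [ks pk]]].
case lax: (T a x).
  exists 0 => /=; rewrite xs ps lax !andbT; split=> //.
  by apply: sub_all xs => y; apply: trT.
exists k.+1; split=> //=; rewrite pk andbT.
move: xs; rewrite -{1}(cat_take_drop k s) !all_cat /= => /andP[-> ->].
by rewrite (T_total tT ax lax).
Qed.

(** * The types realized in the hypergraph *)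

Section Types.
Variables (V : countType) (F : {fset V} -> Prop) (T : rel V).
Hypotheses (infV : countably_infinite V) (homF : le_set_hom F 4).
Hypotheses (tT : tournament T) (autT : forall g x y, is_aut F g -> T (g x) (g y) = T x y).
Hypothesis hom2 : forall x y x' y', T x y -> T x' y' -> exists g, [/\ is_aut F g, g x = x' & g y = y'].
Hypothesis trT : forall x y z, T x y -> T y z -> T x z.
Hypothesis color_ex : forall v, exists x y z, pairwise T [:: x; y; z] /\ Fs F [:: x; y; z] = v.
Local Notation Fs := (Fs F).

Definition realized (t : seq bool) : Prop :=
  exists s, [/\ pairwise T s, size s = 4 & ty F s = t].

Lemma nth_ty s i : pairwise T s -> size s = 4 -> i < 4 -> nth false (ty F s) i = Fs (omit i s).
Proof.
case: s => [|a [|b [|c [|d []]]]] // ps _ i4; rewrite ty4E; last exact: (pairwise_T_uniq tT ps).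
by case: i i4 => [|[|[|[|i]]]].
Qed.

Lemma size_ty s : size (ty F s) = size s.
Proof. by rewrite size_map. Qed.

Lemma aut_ty g s : is_aut F g -> pairwise T s -> size s = 4 -> ty F (map g s) = ty F s.
Proof.
move=> ga ps s4; have pg : pairwise T (map g s).
  by rewrite pairwise_map; apply: sub_pairwise ps => x y; rewrite /relpre /= autT.
have sg : size (map g s) = 4 by rewrite size_map.
apply: (@eq_from_nth _ false); first by rewrite !size_ty size_map.
move=> i; rewrite size_ty sg => i4; rewrite !nth_ty // /omit -map_take -map_drop -map_cat.
apply: aut_Fs => //; first by apply: (pairwise_T_uniq tT); apply: pairwise_omit.
by rewrite size_omit ?s4.
Qed.

Lemma realized_size t : realized t -> size t = 4.
Proof. by move=> [s [_ s4 <-]]; rewrite size_ty. Qed.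

(** The automorphism between the two 4-sets respects the order, hence carries each deleted point to
    the one of the same index. *)
Lemma realized_inj t t' : realized t -> realized t' -> count id t = count id t' -> t = t'.
Proof.
move=> [s [ps s4 <-]] [s' [ps' s4' <-]] e.
have [g ga gp] := seq_hom4 homF (pairwise_T_uniq tT ps) (pairwise_T_uniq tT ps') s4 s4' e.
by rewrite -(aut_ty ga ps s4) (pairwise_aut tT autT ga ps ps' gp).
Qed.

Lemma realized_ext t i s : realized t -> i < 4 -> pairwise T s -> size s = 3 ->
  Fs s = nth false t i -> exists q, [/\ pairwise T q, size q = 4, omit i q = s & ty F q = t].
Proof.
move=> [r [pr r4 <-]] i4 ps s3; rewrite nth_ty // => e.
have po := pairwise_omit i pr.
have so : size (omit i r) = 3 by rewrite size_omit r4.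
have [g ga gp] := seq_hom3 homF (pairwise_T_uniq tT po) (pairwise_T_uniq tT ps) so s3 (esym e).
exists (map g r); split; last exact: aut_ty.
- by rewrite pairwise_map; apply: sub_pairwise pr => x y; rewrite /relpre /= autT.
- by rewrite size_map.
by rewrite -(pairwise_aut tT autT ga po ps gp) /omit map_cat map_take map_drop.
Qed.

Lemma pair_ext x y i v : T x y -> i < 3 -> exists q, [/\ pairwise T q, size q = 3, omit i q = [:: x; y] & Fs q = v].
Proof.
move=> xy i3; have [a [b [c [p e]]]] := color_ex v.
have [u [w o]] : exists u w, omit i [:: a; b; c] = [:: u; w].
  by case: i i3 => [|[|[|i]]] // _; [exists b, c | exists a, c | exists a, b].
have uw : T u w by have := pairwise_omit i p; rewrite o /= !andbT.
have [g [ga gx gy]] := hom2 uw xy; exists (map g [:: a; b; c]); split=> //.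
- by rewrite pairwise_map; apply: sub_pairwise p => z t; rewrite /relpre /= autT.
- by rewrite /omit -map_take -map_drop -map_cat -/(omit i _) o /= gx gy.
by rewrite aut_Fs // (pairwise_T_uniq tT p).
Qed.

Lemma realized_amalgamable TT t u i j : (forall t, realized t <-> t \in TT) ->
  realized t -> realized u -> i < 4 -> j < 4 -> nth false t i = nth false u j ->
  amalgamable TT t i u j.
Proof.
move=> TTP [s [ps s4 ets]] ru i4 j4 e; apply/orP.
have x0 : V by case: s s4 {ps ets}.
have po := pairwise_omit i ps.
have so : size (omit i s) = 3 by rewrite size_omit s4.
have [|s' [ps' s4' os' eus]] := realized_ext ru j4 po so.
  by rewrite -nth_ty // ets.
pose b := nth x0 s' j; pose a := nth x0 s i.
have us := pairwise_T_uniq tT ps; have us' := pairwise_T_uniq tT ps'.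
have pa : perm_eq s (a :: omit i s) by apply: perm_omit; rewrite s4.
have pb : perm_eq s' (b :: omit i s) by rewrite -os'; apply: perm_omit; rewrite s4'.
have [ab|ab] := eqVneq a b.
  have ss' : s = s' by apply: (pairwise_perm_eq tT ps ps'); rewrite (perm_trans pa) // ab perm_sym.
  left; rewrite -ets -eus ss' eqxx andbT.
  by rewrite -(nth_uniq x0 _ _ us') ?s4' // -/b -ab /a ss'.
right; have bs : b \notin s.
  rewrite (perm_mem pa) inE eq_sym (negbTE ab) /=.
  by have := us'; rewrite (perm_uniq pb) /= => /andP[].
(* Inserting [b] at position [k] moves [a] from [i] to [l = bump k i]. Deleting [a] must leave [b]
   at its index [j] in [s'], whence [bump l j = k]. *)
have [k [ks pk]] := pairwise_insert tT trT ps bs.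
set q := take k s ++ b :: drop k s in pk.
have q5 : size q = 5 by rewrite size_cat /= addnS -size_cat cat_take_drop s4.
have oq : omit k q = s.
  rewrite /omit /q take_size_cat ?size_takel // -cat_rcons drop_size_cat ?cat_take_drop //.
  by rewrite size_rcons size_takel.
have k5 : k < size q by rewrite q5 ltnS -s4.
have qk : nth x0 q k = b by rewrite /q nth_cat size_takel // ltnn subnn.
pose l := bump k i; have l5 : l < 5 by rewrite /l /bump; case: (k <= i); rewrite ?add1n ?add0n ltnS // ltnW.
have ql : nth x0 q l = a by rewrite -nth_omit // oq.
have uq := pairwise_T_uniq tT pk.
have ol : omit l q = s'.
  apply: (pairwise_perm_eq tT _ ps'); first exact: pairwise_omit.
  rewrite -(perm_cons a) -{1}ql perm_sym (perm_trans _ (perm_omit x0 _)) ?q5 //.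
  rewrite perm_sym (perm_trans (perm_omit x0 k5)) // qk oq.
  rewrite perm_sym (perm_trans (_ : perm_eq _ (a :: b :: omit i s))) ?perm_cons //.
  rewrite -cat1s -[b :: _]cat1s perm_catCA /= perm_cons perm_sym //.
apply/hasP; exists k; first by rewrite mem_iota -q5.
rewrite -/l; apply/andP; split.
  have bl5 : bump l j < size q by rewrite q5 /bump; case: (l <= j); rewrite ?add1n ?add0n ltnS // ltnW.
  by rewrite -(nth_uniq x0 bl5 k5 uq) qk -nth_omit ?q5 // ol.
set cands := map _ _.
suff h : mkseq (fun m => ty F (omit m q)) (size cands) \in fillings cands by case: (fillings cands) h.
have sc : size cands = 5 by rewrite size_map.
apply: fillings_mkseq; rewrite sc.
  move=> m m5; rewrite (nth_map 0) ?size_iota // nth_iota // add0n.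
  case: eqP => [->|_]; first by rewrite oq ets mem_head.
  case: eqP => [->|_]; first by rewrite ol eus mem_head.
  apply/TTP; exists (omit m q); split=> //; first exact: pairwise_omit.
  by rewrite size_omit q5.
move=> i' m /andP[im m5]; have m4 : m.-1 < 4 by case: (m) m5.
have i5 := ltn_trans im m5; have i'4 : i' < 4 by rewrite -ltnS (leq_trans _ m5) // ltnS.
have so' n : n < 5 -> size (omit n q) = 4 by move=> n5; rewrite size_omit q5.
(* Both sides delete [i'] and [m] from [q]: once [m] is gone, [i' < m] keeps its index, while once
   [i'] is gone, [m] has index [m.-1]. *)
rewrite !nth_ty ?so' ?pairwise_omit //; congr Fs.
case: (q) q5 => [|q0 [|q1 [|q2 [|q3 [|q4 []]]]]] // _.
by case: m m5 im {m4} => [|[|[|[|[|m]]]]] // _; case: i' {i5 i'4} => [|[|[|[|i']]]].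
Qed.

Lemma pair_ext_below x y v : T x y -> exists2 z, T z x & Fs [:: z; x; y] = v.
Proof.
move=> xy; have [q [p q3 o e]] := pair_ext v xy (isT : 0 < 3).
case: q q3 p o e => [|a [|b [|c []]]] // _ p [e1 e2] e3.
by exists a; rewrite -e1 -?e2 //; case/and3P: p => /andP[].
Qed.

Lemma pair_ext_between x y v : T x y -> exists z, [/\ T x z, T z y & Fs [:: x; z; y] = v].
Proof.
move=> xy; have [q [p q3 o e]] := pair_ext v xy (isT : 1 < 3).
case: q q3 p o e => [|a [|b [|c []]]] // _ p [e1 e2] e3.
by exists b; rewrite -e1 -?e2 //; case/and3P: p => /andP[ab _] /andP[bc _].
Qed.

Lemma pair_ext_above x y v : T x y -> exists2 z, T y z & Fs [:: x; y; z] = v.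
Proof.
move=> xy; have [q [p q3 o e]] := pair_ext v xy (isT : 2 < 3).
case: q q3 p o e => [|a [|b [|c []]]] // _ p [e1 e2] e3.
by exists c; rewrite -?e1 -?e2 //; case/and3P: p => _ /andP[bc _].
Qed.

Lemma triple_ext s i : pairwise T s -> size s = 3 -> i < 4 ->
  exists q, [/\ pairwise T q, size q = 4 & omit i q = s].
Proof.
case: s => [|x [|y [|z []]]] // /and4P[/and3P[xy xz _] /andP[yz _] _ _] _.
case: i => [|[|[|[|]]]] // _.
- have [w wx _] := pair_ext_below true xy; exists [:: w; x; y; z].
  by rewrite /= xy xz yz wx (trT wx xy) (trT wx xz).
- have [w [xw wy _]] := pair_ext_between true xy; exists [:: x; w; y; z].
  by rewrite /= xy xz yz xw wy (trT wy yz).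
- have [w [yw wz _]] := pair_ext_between true yz; exists [:: x; y; w; z].
  by rewrite /= xy xz yz yw wz (trT xy yw).
have [w zw _] := pair_ext_above true yz; exists [:: x; y; z; w].
by rewrite /= xy xz yz zw (trT yz zw) (trT xz zw).
Qed.

Lemma mem_bool_seqs t : t \in bool_seqs (size t).
Proof.
elim: t => [|b t IH]; first by [].
by apply/allpairsP; exists (b, t); rewrite IH; case: b.
Qed.

Lemma realized_set ws : exists2 TT, TT \in type_sets ws &
  forall t, t \in TT <-> realized t /\ count id t \in ws.
Proof.
elim: ws => [|w ws [TT TTin TTP]]; first by exists [::] => // t; split=> // -[].
have [p pw pP] : exists2 p, p \in weight_choices w &
    forall t, t \in p <-> realized t /\ count id t = w.
  have [[t [rt tw]]|no] := classic (exists t, realized t /\ count id t = w); last first.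
    by exists [::]; [rewrite mem_head | move=> t; split=> // rt; case: no; exists t].
  exists [:: t].
    rewrite inE; apply/orP; right; apply/mapP; exists t => //.
    by rewrite mem_filter tw eqxx -(realized_size rt) mem_bool_seqs.
  move=> u; rewrite inE; split=> [/eqP-> //|[ru uw]].
  by apply/eqP; apply: realized_inj; rewrite ?uw.
exists (p ++ TT); first by apply/allpairsP; exists (p, TT).
move=> t; rewrite mem_cat inE; split=> [/orP[/pP[rt ->]|/TTP[rt ->]]|[rt]].
- by rewrite eqxx.
- by rewrite orbT.
by case/orP=> [/eqP h|h]; apply/orP; [left; apply/pP | right; apply/TTP].
Qed.

Lemma realized_types :
  (forall t, realized t <-> t \in M3_types) \/
  (forall t, realized t <-> t \in [seq rev t | t <- M3_types]).
Proof.
have [TT TTin TTP'] := realized_set (iota 0 5).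
have TTP t : realized t <-> t \in TT.
  split=> [rt|/TTP' [] //]; apply/TTP'; split=> //.
  by rewrite mem_iota add0n ltnS -(realized_size rt) count_size.
have := allP amalgamation_classes TT TTin.
suff -> : amalgamation_class TT.
  by rewrite !inE => /orP[]/eqP e; [left | right]; rewrite -e.
have rq q : pairwise T q -> size q = 4 -> ty F q \in TT.
  by move=> pq q4; apply/TTP; exists q.
apply/and3P; split.
(* Over the arc from [x] to [y] third points of both colours exist; one of each yields a type of
   mixed colours. *)
- have [x [y [z [p _]]]] := color_ex true.
  have xy : T x y by case/and3P: p => /andP[].
  have [u yu eu] := pair_ext_above true xy; have [w yw ew] := pair_ext_above false xy.
  have nuw : u != w by apply: contraTneq eu => ->; rewrite ew.
  apply/hasP; case uw: (T u w).
    have pq : pairwise T [:: x; y; u; w] by rewrite /= xy yu yw uw (trT xy yu) (trT xy yw).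
    exists (ty F [:: x; y; u; w]); first exact: rq.
    by rewrite ty4E ?(pairwise_T_uniq tT pq) //= eu ew /= !orbT !andbF.
  have wu := T_total tT nuw uw.
  have pq : pairwise T [:: x; y; w; u] by rewrite /= xy yu yw wu (trT xy yu) (trT xy yw).
  exists (ty F [:: x; y; w; u]); first exact: rq.
  by rewrite ty4E ?(pairwise_T_uniq tT pq) //= eu ew /= !orbT !andbF.
- apply/allP=> i; rewrite mem_iota => /andP[_ i4]; apply/allP=> v _.
  have [x [y [z [p e]]]] := color_ex v.
  have [q [pq q4 oq]] := triple_ext p erefl i4.
  by apply/hasP; exists (ty F q); [exact: rq | rewrite nth_ty // oq e].
apply/allP=> t /TTP rt; apply/allP=> u /TTP ru; apply/allP=> i; rewrite mem_iota => /andP[_ i4].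
apply/allP=> j; rewrite mem_iota => /andP[_ j4]; apply/implyP=> /eqP.
exact: realized_amalgamable.
Qed.

End Types.

(** * Recognition of the C-relation *)

Section Recognition.
Variables (V : countType) (F : {fset V} -> Prop) (T : rel V).
Hypotheses (infV : countably_infinite V) (homF : le_set_hom F 4).
Hypotheses (tT : tournament T) (autT : forall g x y, is_aut F g -> T (g x) (g y) = T x y).
Hypothesis hom2 : forall x y x' y', T x y -> T x' y' -> exists g, [/\ is_aut F g, g x = x' & g y = y'].
Hypothesis trT : forall x y z, T x y -> T y z -> T x z.
Hypothesis color_ex : forall v, exists x y z, pairwise T [:: x; y; z] /\ Fs F [:: x; y; z] = v.
Hypothesis M3_realized : forall t, realized F T t <-> t \in M3_types.

Definition e3 x y z : bool := Fs F [:: x; y; z].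

Lemma e132 x y z : e3 x z y = e3 x y z.
Proof. by apply: eq_Fs => u; rewrite !inE [(u == z) || _]orbC. Qed.
Lemma e213 x y z : e3 y x z = e3 x y z.
Proof. by apply: eq_Fs => u; rewrite !inE orbCA. Qed.
Lemma e231 x y z : e3 y z x = e3 x y z. Proof. by rewrite e132 e213. Qed.
Lemma e312 x y z : e3 z x y = e3 x y z. Proof. by rewrite e213 e132. Qed.
Lemma e321 x y z : e3 z y x = e3 x y z. Proof. by rewrite e213 e231. Qed.

Definition leT x y : Prop := x = y \/ T x y.

(** Read off from [M3_edgeP] and [M3_nonedgeP]: two points of a cone at [x] lie on one side of [x],
    and form an edge with it if they are above, a non-edge if below. The case [y == z] is (C4). *)
Definition CT x y z : bool := [&& x != y, x != z &
  [|| y == z, [&& T x y, T x z & e3 x y z] | [&& T y x, T z x & ~~ e3 x y z]]].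

Lemma ltT x y : lt leT x y <-> T x y.
Proof.
split=> [[[->|//] //]|xy]; split; first by right.
by apply/eqP/(T_neq tT).
Qed.

Lemma quad_types a b c d : T a b -> T b c -> T c d ->
  [:: e3 b c d; e3 a c d; e3 a b d; e3 a b c] \in M3_types.
Proof.
move=> ab bc cd; have p : pairwise T [:: a; b; c; d].
  by rewrite /= ab bc cd (trT ab bc) (trT bc cd) (trT (trT ab bc) cd).
by rewrite -(ty4E F (pairwise_T_uniq tT p)); apply/M3_realized; exists [:: a; b; c; d].
Qed.

Lemma T_cmp x y : x != y -> T x y \/ T y x.
Proof. by move=> xy; case h: (T x y); [left | right; apply: (T_total tT)]. Qed.

Lemma T_neqr x y : T x y -> y != x.
Proof. by rewrite eq_sym; apply: (T_neq tT). Qed.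

(** Once the order of the points is known, [CT] is a Boolean expression in the colours of the
    increasing triples, and claims about four points are checked against [M3_types]. *)
Ltac eval_pair ab := rewrite ?ab ?(T_asym tT ab) ?(negbTE (T_neq tT ab)) ?(negbTE (T_neqr ab)) /=.
Ltac norm a b c := rewrite ?(e132 a b c) ?(e213 a b c) ?(e231 a b c) ?(e312 a b c) ?(e321 a b c).
Ltac solve_triple ab bc :=
  let ac := fresh in have ac := trT ab bc;
  match type of ab with is_true (T ?a ?b) => match type of bc with is_true (T _ ?c) =>
    rewrite /CT; eval_pair ab; eval_pair bc; eval_pair ac; norm a b c; by case: (e3 a b c)
  end end.
Ltac solve_quad ab bc cd :=
  let ac := fresh in let bd := fresh in let ad := fresh in
  have ac := trT ab bc; have bd := trT bc cd; have ad := trT ab bd;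
  match type of ab with is_true (T ?a ?b) => match type of cd with is_true (T ?c ?d) =>
    move: (quad_types ab bc cd); rewrite /CT; eval_pair ab; eval_pair bc; eval_pair cd;
    eval_pair ac; eval_pair bd; eval_pair ad; norm a b c; norm a b d; norm a c d; norm b c d;
    by case: (e3 a b c); case: (e3 a b d); case: (e3 a c d); case: (e3 b c d)
  end end.

Lemma T_cases3 (P : Prop) x y z : x != y -> y != z -> x != z ->
  (T x y -> T y z -> P) -> (T x z -> T z y -> P) -> (T y x -> T x z -> P) ->
  (T y z -> T z x -> P) -> (T z x -> T x y -> P) -> (T z y -> T y x -> P) -> P.
Proof.
move=> xy yz xz; case: (T_cmp xy) => ?; case: (T_cmp yz) => ?; case: (T_cmp xz) => ? h1 h2 h3 h4 h5 h6;
  by [exact: h1 | exact: h2 | exact: h3 | exact: h4 | exact: h5 | exact: h6].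
Qed.

Lemma T_insert (P : Prop) a b c w : T a b -> T b c -> w != a -> w != b -> w != c ->
  (T w a -> P) -> (T a w -> T w b -> P) -> (T b w -> T w c -> P) -> (T c w -> P) -> P.
Proof.
move=> ab bc wa wb wc h1 h2 h3 h4; case: (T_cmp wa) => ?; first exact: h1.
by case: (T_cmp wb) => ?; [exact: h2 | case: (T_cmp wc) => ?; [exact: h3 | exact: h4]].
Qed.

Lemma CT_swap x y z : CT x y z = CT x z y.
Proof. by rewrite /CT e132 [z == y]eq_sym andbCA [T x z && (T x y && _)]andbCA [T z x && (T y x && _)]andbCA. Qed.

Lemma CT_asym x y z : CT x y z -> ~~ CT y x z.
Proof.
have [->|yz] := eqVneq y z; first by rewrite {2}/CT eqxx /= andbF.
have [->|xy] := eqVneq x y; first by rewrite /CT eqxx.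
have [->|xz] := eqVneq x z; first by rewrite /CT eqxx /= andbF.
by apply: (T_cases3 xy yz xz) => h1 h2; solve_triple h1 h2.
Qed.

Lemma CT_cut x y z w : CT x y z -> CT x w z || CT w y z.
Proof.
have [->|xy] := eqVneq x y; first by rewrite /CT eqxx.
have [->|xz] := eqVneq x z; first by rewrite /CT eqxx /= andbF.
have [->|wx] := eqVneq w x; first by move=> ->; rewrite orbT.
have [->|wy] := eqVneq w y; first by move=> ->.
have [->|wz] := eqVneq w z; first by rewrite /CT xz eqxx.
have [->|yz] := eqVneq y z; first by rewrite {3}/CT wz eqxx orbT.
(* Six orders of [x], [y], [z] and four places for [w]. *)
by apply: (T_cases3 xy yz xz) => h1 h2;
  apply: (T_insert (w := w) h1 h2) => // [h3|h3 h4|h3 h4|h3];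
  first [solve_quad h3 h1 h2 | solve_quad h3 h4 h2 | solve_quad h1 h3 h4 | solve_quad h1 h2 h3].
Qed.


Lemma CT_edge x y z : T x y -> T x z -> e3 x y z -> CT x y z.
Proof. by move=> xy xz e; rewrite /CT xy xz e (T_neq tT xy) (T_neq tT xz) orbT. Qed.

Lemma CT_nonedge x y z : T y x -> T z x -> e3 x y z = false -> CT x y z.
Proof. by move=> yx zx e; rewrite /CT yx zx e (T_neqr yx) (T_neqr zx) !orbT. Qed.

Lemma CT_diag x y : x != y -> CT x y y.
Proof. by move=> xy; rewrite /CT xy eqxx. Qed.

Lemma CT_inv x y z : CT x y z -> y = z \/ [/\ T x y, T x z & e3 x y z] \/ [/\ T y x, T z x & e3 x y z = false].
Proof.
by case/and3P=> _ _ /or3P[/eqP|/and3P[]|/and3P[? ? /negbTE]]; [left | right; left | right; right].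
Qed.

Lemma quad_ext t i a b c : t \in M3_types -> i < 4 -> T a b -> T b c -> e3 a b c = nth false t i ->
  exists q, [/\ pairwise T q, size q = 4, omit i q = [:: a; b; c] & ty F q = t].
Proof.
move=> /M3_realized rt i4 ab bc e; apply: (realized_ext homF tT autT) => //.
by rewrite /= ab bc (trT ab bc).
Qed.

(** The new point must branch off between [x] and the pair [y z], on a prescribed side of the pair.
    The four types used are the trees x(w(yz)), x((yz)w), (w(yz))x and ((yz)w)x; the index [i] is
    the place of [w]. *)
Lemma CT_dense x y z : y != z -> T y z -> CT x y z ->
  (exists w, [/\ CT w y z, CT x y w & T w y]) /\ (exists w, [/\ CT w y z, CT x y w & T z w]).
Proof.
move=> nyz yz /CT_inv[e|[[xy xz e]|[yx zx e]]]; first by rewrite e eqxx in nyz.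
- split.
    have [|q [pq q4 oq tq]] := quad_ext (t := [:: true; true; true; true]) (i := 1) isT isT xy yz; first exact: e.
    case: q q4 pq oq tq => [|x' [|w [|y' [|z' []]]]] // _ pq [? ? ?]; subst x' y' z'.
    rewrite ty4E ?(pairwise_T_uniq tT pq) // => -[e1 e2 e3 e4].
    move: pq => /and5P[/and4P[xw _ _ _] /and3P[wy wz _] _ _ _].
    exists w; split=> //; first exact: CT_edge.
    by apply: CT_edge; rewrite // e132.
  have [|q [pq q4 oq tq]] := quad_ext (t := [:: false; true; true; true]) (i := 3) isT isT xy yz; first exact: e.
  case: q q4 pq oq tq => [|x' [|y' [|z' [|w []]]]] // _ pq [? ? ?]; subst x' y' z'.
  rewrite ty4E ?(pairwise_T_uniq tT pq) // => -[e1 e2 e3' e4].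
  move: pq => /and5P[/and4P[_ _ xw _] /and3P[_ yw _] /andP[zw _] _ _].
  exists w; split=> //; first by apply: CT_nonedge; rewrite // e312.
  exact: CT_edge.
have e' : e3 y z x = false by rewrite e231.
split.
  have [|q [pq q4 oq tq]] := quad_ext (t := [:: false; false; false; true]) (i := 0) isT isT yz zx; first exact: e'.
  case: q q4 pq oq tq => [|w [|y' [|z' [|x' []]]]] // _ pq [? ? ?]; subst x' y' z'.
  rewrite ty4E ?(pairwise_T_uniq tT pq) // => -[e1 e2 e3' e4].
  move: pq => /and5P[/and4P[wy wz wx _] _ _ _ _].
  exists w; split=> //; first exact: CT_edge.
  by apply: CT_nonedge; rewrite // e321.
have [|q [pq q4 oq tq]] := quad_ext (t := [:: false; false; false; false]) (i := 2) isT isT yz zx; first exact: e'.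
case: q q4 pq oq tq => [|y' [|z' [|w [|x' []]]]] // _ pq [? ? ?]; subst x' y' z'.
rewrite ty4E ?(pairwise_T_uniq tT pq) // => -[e1 e2 e3' e4].
move: pq => /and5P[/and4P[_ yw _ _] /and3P[zw _ _] /andP[wx _] _ _].
exists w; split=> //; first by apply: CT_nonedge; rewrite // e312.
by apply: CT_nonedge; rewrite // e312.
Qed.

Lemma CT_structure : CL_structure CT leT.
Proof.
have below := pair_ext_below tT autT hom2 color_ex.
have between := pair_ext_between tT autT hom2 color_ex.
have above := pair_ext_above tT autT hom2 color_ex.
have other (x : V) : exists y, y != x by have [y] := infV [:: x]; rewrite inE; exists y.
split.
- split; first by move=> x y z; rewrite CT_swap.
  split; first by move=> x y z /CT_asym/negP.
  split; first by move=> x y z w /CT_cut => /(_ w)/orP.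
  split; first by move=> x y /eqP; apply: CT_diag.
  split=> [y z|x y /eqP xy].
    have [->|yz] := eqVneq y z; first by have [x xz] := other z; exists x; apply: CT_diag.
    case: (T_cmp yz) => l; have [x xy e] := below _ _ true l; exists x.
      by apply: CT_edge => //; exact: trT xy l.
    by rewrite CT_swap; apply: CT_edge => //; exact: trT xy l.
  case: (T_cmp xy) => l.
    have [z yz e] := above _ _ true l; exists z; split; first exact/eqP/(T_neq tT).
    by apply: CT_edge => //; exact: trT l yz.
  have [z zy e] := below _ _ false l; exists z; split; first exact/eqP/T_neqr.
  by apply: CT_nonedge => //; [exact: trT zy l | rewrite e321].
- move=> x y z /eqP xy /eqP yz /eqP xz.
  suff : [|| CT x y z, CT y x z | CT z x y] by case/or3P; auto.
  by apply: (T_cases3 xy yz xz) => h1 h2; solve_triple h1 h2.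
- split; first by left.
  split=> [x y [//|xy] [//|yx]|]; first by rewrite (T_asym tT xy) in yx.
  split=> [x y z [->//|xy] [<-|yz]|x y]; [by right | by right; exact: trT xy yz |].
  have [->|/T_cmp[]] := eqVneq x y; first by left; left.
    by left; right.
  by right; right.
- move=> x y z /ltT xy /ltT yz; suff : CT x y z || CT z x y by move/orP.
  by solve_triple xy yz.
split=> [x y /ltT xy|]; first by have [z [xz zy _]] := between _ _ true xy; exists z; split; apply/ltT.
split=> [x|].
  have [y /T_cmp[l|l]] := other x; first by exists y; apply/ltT.
  by have [z zx _] := below _ _ true l; exists z; apply/ltT.
split=> [x|x y z].
  have [y /T_cmp[l|l]] := other x; last by exists y; apply/ltT.
  by have [z zx _] := above _ _ true l; exists z; apply/ltT.
(* For [y = z], (C8) asks for points of the cone of [y] at [x] on both sides of [y]; they come from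
   extensions of a pair, the other cases from [CT_dense]. *)
have [->|nyz] := eqVneq y z.
  case/and3P=> xz _ _; case: (T_cmp xz) => l.
    have [w [xw wz e]] := between _ _ true l; have [u zu e'] := above _ _ true l.
    split; [exists w | exists u]; split; rewrite ?CT_diag ?(T_neq tT wz) ?(T_neqr zu) //.
    - by split; [rewrite CT_swap; apply: CT_edge | split; apply/ltT].
    - by split; [apply: CT_edge => //; exact: trT l zu | split; apply/ltT].
  have [w [zw wx e]] := between _ _ false l; have [u uz e'] := below _ _ false l.
  split; [exists u | exists w]; split; rewrite ?CT_diag ?(T_neq tT uz) ?(T_neqr zw) //.
  - by split; [apply: CT_nonedge => //; [exact: trT uz l | rewrite e321] | split; apply/ltT].
  - by split; [apply: CT_nonedge => //; rewrite e312 | split; apply/ltT].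
move=> c; case: (T_cmp nyz) => l.
  have [[w1 [c1 x1 l1]] [w2 [c2 x2 l2]]] := CT_dense nyz l c; split; [exists w1 | exists w2].
    by split=> //; split=> //; split; apply/ltT => //; exact: trT l1 l.
  by split=> //; split=> //; split; apply/ltT => //; exact: trT l l2.
rewrite CT_swap in c; rewrite eq_sym in nyz.
have [[w1 [c1 x1 l1]] [w2 [c2 x2 l2]]] := CT_dense nyz l c.
(* Transitivity within a cone as in [C_trans], derived here from (C2) and (C3) because the structure
   is still being built. *)
have tr t : CT x z t -> CT x y t.
  move=> h; case/orP: (CT_cut t c) => [|h3]; first by rewrite CT_swap.
  case/orP: (CT_cut y h) => // h4.
  by move: (CT_asym (x := y) (y := t) (z := z)); rewrite CT_swap h4 [CT t _ _]CT_swap h3 => /(_ isT).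
split; [exists w1 | exists w2]; rewrite [CT _ y z]CT_swap.
  by split=> //; split; [exact: tr | split; apply/ltT => //; exact: trT l1 l].
by split=> //; split; [exact: tr | split; apply/ltT => //; exact: trT l l2].
Qed.

End Recognition.

(** * The classification *)

Lemma FsE (V : countType) (F : {fset V} -> Prop) x y z : Fs F [:: x; y; z] <-> F [fset x; y; z].
Proof.
have -> : [fset x; y; z] = [fset i in [:: x; y; z]] by apply/fsetP=> i; rewrite !inE orbF orbA.
by split=> /asboolP.
Qed.

Lemma M3_edge_CT (V : countType) (F : {fset V} -> Prop) (T : rel V) :
  tournament T -> CL_structure (CT F T) (leT T) ->
  forall S, #|` S| = 3 -> (F S <-> M3_edge (CT F T) (leT T) S).
Proof.
move=> tT cl S /(sorted3 cl)[x [y [z [-> xy yz]]]]; have xz := lt_trans cl xy yz.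
rewrite (M3_edgeP cl xy xz (lt_neq yz)) -FsE.
move/(ltT tT): xy => xy; move/(ltT tT): xz => xz; move/(ltT tT): yz => yz.
rewrite /CT xy xz (T_asym tT xy) (T_neq tT xy) (T_neq tT xz) (negbTE (T_neq tT yz)) /= orbF.
by split.
Qed.

Lemma swap_bij (V : eqType) (a b : V) : exists g : V -> V, [/\ bijective g, g a = b &
  forall x, x != a -> x != b -> g x = x].
Proof.
pose g x := if x == a then b else if x == b then a else x.
have ga : g a = b by rewrite /g eqxx.
exists g; split=> // [|x /negbTE xa /negbTE xb]; last by rewrite /g xa xb.
apply: inv_bij => x; rewrite /g; have [->|xa] := eqVneq x a; last have [->|xb] := eqVneq x b.
- by rewrite eqxx; case: eqP.
- by rewrite eqxx.
by rewrite (negbTE xa) (negbTE xb).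
Qed.

(** If only one colour occurred, every bijection would be an automorphism, and two transpositions
    carry any ordered pair to any other. *)
Lemma both_colors (V : countType) (F : {fset V} -> Prop) : ~ two_transitive F ->
  forall v, exists x y z, uniq [:: x; y; z] /\ Fs F [:: x; y; z] = v.
Proof.
move=> n2 v; apply: NNPP => no; apply: n2 => a b c d ab cd.
have aut g : bijective g -> is_aut F g.
  move=> bg; split=> // S /cardfs3P[x [y [z [-> /eqP xy /eqP yz /eqP xz]]]].
  have col u w t : uniq [:: u; w; t] -> Fs F [:: u; w; t] = ~~ v.
    move=> un; apply/eqP; apply: contraT => e; case: no; exists u, w, t; split=> //.
    by move: e; case: (Fs _ _); case: (v).
  have un : uniq [:: x; y; z] by rewrite /= !inE negb_or xy xz yz.
  have ug : uniq (map g [:: x; y; z]) by rewrite map_inj_uniq //; exact: bij_inj.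
  by rewrite imfset3 -!FsE (col _ _ _ un) (col _ _ _ ug).
have [g [bg ga gn]] := swap_bij a c; have [h [bh hb hn]] := swap_bij (g b) d.
exists (h \o g); split; first exact/aut/bij_comp.
split=> /=; last exact: hb.
rewrite ga hn //; last exact/eqP.
by rewrite -ga (inj_eq (bij_inj bg)); apply/eqP.
Qed.

Lemma ordered_classification (V : countType) (F : {fset V} -> Prop) (T : rel V) :
  countably_infinite V -> le_set_hom F 4 -> tournament T ->
  (forall g x y, is_aut F g -> T (g x) (g y) = T x y) ->
  (forall x y x' y', T x y -> T x' y' -> exists g, [/\ is_aut F g, g x = x' & g y = y']) ->
  (forall x y z, T x y -> T y z -> T x z) ->
  (forall v, exists x y z, pairwise T [:: x; y; z] /\ Fs F [:: x; y; z] = v) ->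
  exists T', tournament T' /\ CL_structure (CT F T') (leT T').
Proof.
move=> infV homF tT autT hom2 trT col.
have [real|real] := realized_types homF tT autT hom2 trT col.
  by exists T; split=> //; apply: CT_structure real.
(* Reversing [T] reverses the types and keeps [F], so the mirror images turn into [M3_types]. *)
pose T' x y := T y x; have tT' : tournament T' := tournament_rev tT.
have pw s : pairwise T' (rev s) = pairwise T s.
  by elim: s => //= x s IH; rewrite rev_cons pairwise_rcons all_rev IH.
have ty_rev s : uniq s -> size s = 4 -> ty F (rev s) = rev (ty F s).
  case: s => [|a [|b [|c [|d []]]]] // us _.
  have ur : uniq (rev [:: a; b; c; d]) by rewrite rev_uniq.
  rewrite (ty4E F us) (ty4E F ur); congr [:: _; _; _; _].
  - exact: (eq_Fs F (mem_rev [:: a; b; c])).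
  - exact: (eq_Fs F (mem_rev [:: a; b; d])).
  - exact: (eq_Fs F (mem_rev [:: a; c; d])).
  exact: (eq_Fs F (mem_rev [:: b; c; d])).
exists T'; split=> //; apply: CT_structure => //.
- by move=> g x y ga; exact: autT.
- by move=> x y x' y' h h'; have [g [ga gx gy]] := hom2 _ _ _ _ h h'; exists g.
- by move=> x y z xy yz; exact: trT yz xy.
- move=> v; have [x [y [z [p e]]]] := col v; exists z, y, x.
  by rewrite -[[:: z; y; x]]/(rev [:: x; y; z]) pw p (eq_Fs F (mem_rev _)).
move=> t; rewrite -(mem_map (inv_inj revK)) -real.
have un := pairwise_T_uniq tT; have un' := pairwise_T_uniq tT'.
split=> -[s [ps s4 e]]; exists (rev s); split; rewrite ?size_rev ?pw //.
- by rewrite -pw revK.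
- by rewrite ty_rev ?un' // e.
by rewrite ty_rev ?un // e revK.
Qed.
Lemma classification (V M : countType) (F : {fset V} -> Prop) C le :
  CL_structure C le -> countably_infinite M ->
  countably_infinite V -> le_set_hom F 4 -> ~ two_transitive F -> hyper_iso F (@M3_edge M C le).
Proof.
move=> clM infM infV homF n2.
have [T [totT irrT autT hom2]] := invariant_tournament homF n2.
have tT : tournament T by [].
have trT := T_trans infV homF tT autT hom2.
have [|T' [tT' clV]] := ordered_classification infV homF tT autT hom2 trT.
  move=> v; have [x [y [z [u e]]]] := both_colors n2 v.
  move: u; rewrite /= !inE negb_or => /andP[/andP[xy xz] /andP[yz _]].
  have pw a b c : T a b -> T b c -> pairwise T [:: a; b; c].
    by move=> ab bc; rewrite /= ab bc (trT _ _ _ ab bc).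
  by apply: (T_cases3 tT xy yz xz) => h1 h2; eexists; eexists; eexists; (split; first exact: pw h1 h2);
    rewrite -e; apply: eq_Fs => i; rewrite !inE; case: (i == x); case: (i == y); case: (i == z).
have [v0 _] := infV [::]; have [m0 _] := infM [::].
have nil : cl_piso (CT F T') (leT T') C le [::] by [].
have [phi [bij _ phiT phiC]] := cl_back_and_forth clV clM (inhabits v0) (inhabits m0) nil.
exists phi; split=> // S S3.
by rewrite (M3_edge_CT tT' clV S3) (M3_iso clV clM phiT phiC S3).
Qed.

Theorem theoremA (M : countType) (C : M -> M -> M -> Prop) (le : M -> M -> Prop) :
  CL_structure C le -> countably_infinite M ->
  [/\ hyper3 (M3_edge C le), set_hom (M3_edge C le),
      ~ homogeneous (M3_edge C le), ~ two_transitive (M3_edge C le) &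
      forall (V : countType) (F : {fset V} -> Prop),
        hyper3 F -> countably_infinite V -> le_set_hom F 4 ->
        ~ two_transitive F -> hyper_iso F (M3_edge C le)].
Proof.
move=> clM infM; split.
- exact: M3_hyper3.
- exact: M3_set_hom.
- exact: M3_not_homogeneous.
- exact: M3_not_two_transitive.
by move=> V F _ infV homF n2; exact: classification.
Qed.
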